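(* Fix $h$. Let $\mathcal{F}^0$ be the feasible set of $(\mathrm{McC}_{hh})$ and let $(\mathcal{F}^n)_{n}$ be any sequence of sets produced by the bound-tightening procedure (OBBT) described in the context, started with $\mathcal{F}^0$. Let $m_n$ denote the optimal objective value of $$(\mathrm{McC}_{hh}^n)\qquad \min\ j\Big(u,\sum_{i=1}^{N_h}w_i\chi_{Q_h^i}\Big)+\alpha\,\mathrm{TV}_h\Big(\sum_{i=1}^{N_h}w_i\chi_{Q_h^i}\Big)\quad\text{s.t.}\quad(u,w_1,\dots,w_{N_h},z_1,\dots,z_{N_h})\in\mathcal{F}^n .$$ Let $\bar w_h$ be (the control component of) a minimizer of $(\mathrm{McC}_h)$ and let $\bar u_h\in U$ be the corresponding solution of $A\bar u_h+(P_h\bar u_h)(P_h\bar w_h)=f$. Then for all $n\in\mathbb{N}$ $$j(\bar u_h,\bar w_h)+\alpha\,\mathrm{TV}(\bar w_h)\ \ge\ m_n-L_w\|w_u-w_\ell\|_{L^\infty}^{1/2}\,(\sqrt d)^{1/2}\,\mathrm{TV}(\bar w_h)^{1/2}\,h^{1/2},$$ where $L_w$ is the Lipschitz constant of $j$ with respect to its second argument on $C$. Moreover, the sequence $(m_n)_n$ is monotonically nondecreasing.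
   Context: Setting. $\Omega\subset\mathbb{R}^d$ is a bounded domain, $H:=L^2(\Omega)$, and the control space is $W:=BV(\Omega)$; $\mathrm{TV}$ is the total variation seminorm, with $\mathrm{TV}(w)=+\infty$ if $w\in L^1(\Omega)\setminus BV(\Omega)$. $U$ is a reflexive Banach space compactly embedded into $H$; identifying $H\cong H^*$ one has compact embeddings $U\hookrightarrow H\cong H^*\hookrightarrow U^*$. $A:U\to U^*$ is linear and bounded with bounded inverse, $f\in U^*$, $\alpha>0$, $j:U\times H\to\mathbb{R}$ is Lipschitz continuous on bounded sets, and $C\subset H$ is nonempty, bounded, closed and convex. For all $(u,w)\in U\times W$ the product $uw$ is a measurable function that is also an element of $U^*$. The state equation $Au+uw=f$ is assumed to have a unique solution $u\in U$ for a given control $w\in C\cap W$. Bounds. There are $u_\ell,u_u\in H$ and $w_\ell,w_u\in L^\infty(\Omega)$ such that $u_\ell\le u\le u_u$ and $w_\ell\le w\le w_u$ a.e. for all $(u,w)\in U\times W$ with $Au+uw=f$ and $w\in C$. Partitions and averaging. For each $h$ from a sequence of mesh sizes, $\mathcal{Q}_h=\{Q_h^1,\dots,Q_h^{N_h}\}$ is a partition of $\Omega$ into intervals ($d=1$), squares ($d=2$), cubes ($d=3$), and so on, with mesh size (maximal edge length) $h$, and $P_hg:=\sum_{i=1}^{N_h}\frac{1}{|Q_h^i|}\int_{Q_h^i}g\,dx\;\chi_{Q_h^i}$ for $g\in L^1(\Omega)$. It is assumed that: (a) for every $w\in BV(\Omega)$ with $w_\ell\le w\le w_u$ a.e. the equation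 $Au+(P_hu)(P_hw)=f$ has a unique solution $u\in U$; (b) there are real numbers $u_\ell^i,u_u^i,w_\ell^i,w_u^i$ (depending on $h$ and $i$) such that $u_\ell^i\le(P_hu)|_{Q_h^i}\le u_u^i$ and $w_\ell^i\le(P_hw)|_{Q_h^i}\le w_u^i$ for all $i$ and for all $w\in C$ with $w_\ell\le w\le w_u$ a.e. and $u\in U$ that solve $Au+(P_hu)(P_hw)=f$; (c) there is a sequence of approximations $(\mathrm{TV}_h)_h$ of $\mathrm{TV}$ such that, for all $h$, $\mathrm{TV}_h:L^1(\Omega)\to[0,\infty]$ is lower semicontinuous, $\mathrm{TV}_h\circ P_h\le\mathrm{TV}$ and $\mathrm{TV}_h\circ P_h\le\mathrm{TV}_h$. $(\mathrm{McC}_h)$: minimize $j(u,w)+\alpha\,\mathrm{TV}(w)$ over $u\in U$, $w\in C$ with $w_\ell\le w\le w_u$ a.e., and $(z_1,\dots,z_{N_h})\in\mathbb{R}^{N_h}$, subject to $Au+\sum_{i=1}^{N_h}z_i\chi_{Q_h^i}=f$ in $U^*$ and, for every $i\in\{1,\dots,N_h\}$, on $Q_h^i$ (where $P_hu,P_hw$ are constant): $z_i\ge u_\ell^iP_hw+(P_hu)w_\ell^i-u_\ell^iw_\ell^i$, $z_i\ge u_u^iP_hw+(P_hu)w_u^i-u_u^iw_u^i$, $z_i\le u_u^iP_hw+(P_hu)w_\ell^i-u_u^iw_\ell^i$, $z_i\le u_\ell^iP_hw+(P_hu)w_u^i-u_\ell^iw_u^i$, $u_\ell^i\le P_hu\le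 u_u^i$. $(\mathrm{McC}_{hh})$: minimize $j(u,w)+\alpha\,\mathrm{TV}_h(w)$ over $u\in U$, $(w_1,\dots,w_{N_h})\in\mathbb{R}^{N_h}$, $(z_1,\dots,z_{N_h})\in\mathbb{R}^{N_h}$, where $w=\sum_{i}w_i\chi_{Q_h^i}$ must satisfy $w\in C$ and $w_\ell\le w\le w_u$ a.e., subject to $Au+\sum_iz_i\chi_{Q_h^i}=f$ in $U^*$ and the same inequalities on $Q_h^i$ for every $i$ as in $(\mathrm{McC}_h)$ with $P_hw$ replaced by $w_i$. OBBT procedure. For $n=1,2,\dots$: choose an arbitrary $i\in\{1,\dots,N_h\}$ and an arbitrary $s\in\{\ell,u\}$; if $s=\ell$ let $\tilde u_\ell^i$ be the minimum, and if $s=u$ let $\tilde u_u^i$ be the maximum, of $(P_hu)|_{Q_h^i}$ over all $(u,w_1,\dots,w_{N_h},z_1,\dots,z_{N_h})\in\mathcal{F}^{n-1}$; let $\mathcal{F}^n$ be the set defined by the same constraints as $\mathcal{F}^{n-1}$ but with the bound $u_s^i$ replaced by $\tilde u_s^i$ everywhere it occurs (including in the inequalities for $z_i$), all other bounds being kept.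
   Formalization: The inequality (not the monotonicity) additionally assumes that the averaged control P_h w̄_h lies in C and satisfies w_ℓ ≤ P_h w̄_h ≤ w_u a.e.; without this the inequality is false. *)

(* Defs.v *)
From HB Require Import structures.
From mathcomp Require Import all_boot all_order all_algebra.
From mathcomp Require Import all_classical all_reals all_analysis.
Set Implicit Arguments.
Unset Strict Implicit.
Unset Printing Implicit Defensive.
Import Order.TTheory GRing.Theory Num.Theory.
Import numFieldNormedType.Exports.
Local Open Scope classical_set_scope.
Local Open Scope ring_scope.

Section lebesgue_tuple.
Context {R : realType}.
Local Notation RR := (measurableTypeR R).

Definition cons_tuple_pair n (p : RR * n.-tuple RR) : n.+1.-tuple RR :=
  [tuple of p.1 :: p.2].

Definition uncons_tuple n (x : n.+1.-tuple RR) : RR * n.-tuple RR :=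
  (thead x, [tuple of behead x]).

Lemma cons_tuple_pairK n : cancel (@cons_tuple_pair n) (@uncons_tuple n).
Proof. by move=> [x t]; congr pair; exact/val_inj. Qed.

Lemma measurable_cons_tuple_pair n :
  measurable_fun [set: RR * n.-tuple RR] (@cons_tuple_pair n).
Proof. exact: measurable_cons. Qed.

Lemma measurable_uncons_tuple n :
  measurable_fun [set: n.+1.-tuple RR] (@uncons_tuple n).
Proof.
apply/measurable_fun_pairP; split; first exact: measurable_tnth.
exact: measurable_behead.
Qed.

Section step.
Context (n : nat) (m : {sigma_finite_measure set (n.-tuple RR) -> \bar R}).

Definition lebesgue_tuple_step : set (n.+1.-tuple RR) -> \bar R :=
  pushforward (lebesgue_measure \x m)%E (@cons_tuple_pair n).

Let step0 : lebesgue_tuple_step set0 = 0%E.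
Proof. by rewrite /lebesgue_tuple_step /pushforward preimage_set0 measure0. Qed.

Let mpre A : measurable A -> measurable (@cons_tuple_pair n @^-1` A).
Proof.
by move=> mA; rewrite -[X in measurable X]setTI; exact: measurable_cons_tuple_pair.
Qed.

Let step_ge0 A : (0 <= lebesgue_tuple_step A)%E.
Proof. by rewrite /lebesgue_tuple_step /pushforward measure_ge0. Qed.

Let step_sigma_additive : semi_sigma_additive lebesgue_tuple_step.
Proof.
move=> F mF tF mUF; rewrite /lebesgue_tuple_step /pushforward preimage_bigcup.
apply: measure_semi_sigma_additive.
- by move=> k; exact: mpre.
- apply/trivIsetP => /= i j _ _ ij; rewrite -preimage_setI.
  by move/trivIsetP : tF => /(_ _ _ _ _ ij) ->//; rewrite preimage_set0.
- by rewrite -preimage_bigcup; exact: mpre.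
Qed.

HB.instance Definition _ := isMeasure.Build _ _ _
  lebesgue_tuple_step step0 step_ge0 step_sigma_additive.

Let step_sigma_finite : sigma_finite setT lebesgue_tuple_step.
Proof.
have [F FT Foo] : sigma_finite setT (lebesgue_measure \x m)%E.
  have /sigma_finiteP[F [TF ndF Foo]] :=
    sigma_finiteT (lebesgue_measure : {sigma_finite_measure set RR -> \bar R}).
  have /sigma_finiteP[G [TG ndG Goo]] := sigma_finiteT m.
  exists (fun k => F k `*` G k).
    rewrite -setXTT TF TG predeqE => -[x y]; split.
      move=> [/= [k _ Fkx] [l _ Gly]]; exists (maxn k l) => //; split.
      - by move: x Fkx; exact/subsetPset/ndF/leq_maxl.
      - by move: y Gly; exact/subsetPset/ndG/leq_maxr.
    by move=> [k _ []/= ? ?]; split; exists k.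
  move=> k; have [? ?] := Foo k; have [? ?] := Goo k.
  split; first exact: measurableX.
  by rewrite product_measure1E// lte_mul_pinfty// ge0_fin_numE.
exists (fun k => @uncons_tuple n @^-1` F k).
  by rewrite -preimage_bigcup -FT preimage_setT.
move=> k; have [mF ltF] := Foo k; split.
  by rewrite -[X in measurable X]setTI; exact: measurable_uncons_tuple.
rewrite /lebesgue_tuple_step /pushforward -comp_preimage.
rewrite (_ : _ \o _ = id) ?preimage_id//.
by apply/funext => p; exact: cons_tuple_pairK.
Qed.

HB.instance Definition _ := Measure_isSigmaFinite.Build _ _ _
  lebesgue_tuple_step step_sigma_finite.

End step.

Fixpoint lebesgue_tuple n : {sigma_finite_measure set (n.-tuple RR) -> \bar R} :=
  match n with
  | 0 => \d_([tuple] : 0.-tuple RR)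
  | n'.+1 => lebesgue_tuple_step (lebesgue_tuple n')
  end.

End lebesgue_tuple.

Section lebesgue_Rd.
Context {R : realType}.
Local Notation RR := (measurableTypeR R).

(* R^d with its Borel sigma-algebra. *)
Definition borelRd (d : nat) := g_sigma_algebraType (@open 'rV[R]_d).

Definition rV_of_tuple d (x : d.-tuple RR) : borelRd d :=
  (\row_i tnth x i : 'rV[R]_d).

Lemma measurable_rV_of_tuple d :
  measurable_fun [set: d.-tuple RR] (@rV_of_tuple d).
Proof.
apply: (@measurability _ _ _ (borelRd d) _ _ (@open 'rV[R]_d)) => //.
move=> _ [A oA <-]; rewrite setTI.
pose P (p : 'rV[rat]_d * nat) :=
  ball (map_mx ratr p.1 : 'rV[R]_d) p.2.+1%:R^-1 `<=` A.
have -> : @rV_of_tuple d @^-1` A =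
    \bigcup_(p in [set p | P p]) [set x : d.-tuple RR |
      forall i, ball (ratr (p.1 ord0 i) : R) p.2.+1%:R^-1 (tnth x i)].
  apply/seteqP; split => x /=.
  - move=> Ax; have /nbhs_ballP[e /= e0 eA] : nbhs (rV_of_tuple x : 'rV[R]_d) A.
      exact: open_nbhs_nbhs.
    have e20 : 0 < e / 2 by rewrite divr_gt0.
    have [k _ /(_ k (leqnn k)) /= ke] := near_infty_natSinv_lt (PosNum e20).
    have /choice[q xq] : forall i, exists q : rat,
        ball (ratr q : R) k.+1%:R^-1 (tnth x i).
      move=> i; have [|q] := @rat_in_itvoo R (tnth x i - k.+1%:R^-1) (tnth x i).
        by rewrite ltrBlDr ltrDl invr_gt0.
      rewrite in_itv/= => /andP[q1 q2]; exists q.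
      rewrite /ball/= ltr_distlC; apply/andP; split.
        by rewrite (lt_trans _ q2)// ltrBlDr ltrDl invr_gt0.
      by rewrite -ltrBlDr.
    exists (\row_i q i, k); last by move=> i /=; rewrite mxE.
    move=> y [_ /= yq]; apply: eA; split => // i j.
    have := yq i j; rewrite !mxE ord1 => {}yq.
    rewrite [e]splitr; apply: (@ball_triangle _ _ (ratr (q j) : R)).
      by apply: ball_sym; apply: le_ball (ltW ke) _ (xq j).
    by apply: le_ball (ltW ke) _ yq.
  - case=> -[q k] /= qkA xqk; apply: qkA; split; first by rewrite invr_gt0.
    by move=> i j; rewrite !mxE ord1; exact: xqk.
rewrite bigcup_mkcond; apply: countable_bigcupT_measurable => // -[q k].
case: ifPn => // _; rewrite (_ : [set _ | _] =
    \bigcap_i (fun x : d.-tuple RR => tnth x i) @^-1`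
               ball (ratr (q ord0 i) : R) k.+1%:R^-1); last first.
  by apply/seteqP; split => x /= xq i; [move=> _|]; exact: xq.
apply: fin_bigcap_measurable => // i _.
rewrite -[X in measurable X]setTI; apply: measurable_tnth => //.
by rewrite ball_itv; exact: measurable_itv.
Qed.

Definition lebesgue_Rd d : set (borelRd d) -> \bar R :=
  pushforward (lebesgue_tuple d) (@rV_of_tuple d).

Section measure.
Variable d : nat.

Let lebesgue_Rd0 : lebesgue_Rd (set0 : set (borelRd d)) = 0%E.
Proof. by rewrite /lebesgue_Rd /pushforward preimage_set0 measure0. Qed.

Let lebesgue_Rd_ge0 (A : set (borelRd d)) : (0 <= lebesgue_Rd A)%E.
Proof. by rewrite /lebesgue_Rd /pushforward measure_ge0. Qed.

Let lebesgue_Rd_sigma_additive : semi_sigma_additive (@lebesgue_Rd d).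
Proof.
have mpre (A : set (borelRd d)) : measurable A ->
    measurable (@rV_of_tuple d @^-1` A).
  by move=> mA; rewrite -[X in measurable X]setTI; exact: measurable_rV_of_tuple.
move=> F mF tF mUF; rewrite /lebesgue_Rd /pushforward preimage_bigcup.
apply: measure_semi_sigma_additive.
- by move=> k; exact: mpre.
- apply/trivIsetP => /= i j _ _ ij; rewrite -preimage_setI.
  by move/trivIsetP : tF => /(_ _ _ _ _ ij) ->//; rewrite preimage_set0.
- by rewrite -preimage_bigcup; exact: mpre.
Qed.

HB.instance Definition _ := isMeasure.Build _ _ _ (@lebesgue_Rd d)
  lebesgue_Rd0 lebesgue_Rd_ge0 lebesgue_Rd_sigma_additive.

End measure.

Lemma lebesgue_tuple_box n (a b : 'I_n -> R) : (forall i, a i <= b i) ->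
  lebesgue_tuple n [set x | forall i, a i < tnth x i < b i] =
  (\prod_(i < n) (b i - a i))%:E.
Proof.
elim: n a b => [|n IH] a b ab.
  by rewrite big_ord0 /= diracE mem_set// => -[].
rewrite big_ord_recl EFinM /= /lebesgue_tuple_step /pushforward.
pose B := [set x : n.-tuple RR |
  forall i, a (lift ord0 i) < tnth x i < b (lift ord0 i)].
rewrite (_ : _ @^-1` _ = `]a ord0, b ord0[%classic `*` B); last first.
  apply/seteqP; split => -[x t]; rewrite /B/= in_itv/=.
    by move=> H; split => [|i]; [exact: (H ord0)|have := H (lift ord0 i); rewrite tnthS].
  move=> [H1 H2] i; case: (unliftP ord0 i) => [k ->|->] //.
  by rewrite tnthS; exact: H2.
have mB : measurable B.
  rewrite (_ : B = \bigcap_i (fun x : n.-tuple RR => tnth x i) @^-1`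
      `]a (lift ord0 i), b (lift ord0 i)[%classic); last first.
    apply/seteqP; split => x; rewrite /B/=.
      by move=> H i _; rewrite /= in_itv; exact: H.
    by move=> H i; have := H i I; rewrite /= in_itv.
  apply: fin_bigcap_measurable => // i _.
  by rewrite -[X in measurable X]setTI; apply: measurable_tnth.
rewrite product_measure1E// IH//; congr (_ * _)%E.
transitivity (lebesgue_measure `]a ord0, b ord0[%classic); first by [].
rewrite lebesgue_measure_itv/= lte_fin; case: ltP => [//|ba].
by rewrite (@le_anti _ _ (a ord0) (b ord0)) ?subrr// ab.
Qed.

Lemma lebesgue_Rd_box d (a b : 'rV[R]_d) : (forall k, a 0 k <= b 0 k) ->
  @lebesgue_Rd d [set x : 'rV[R]_d | forall k, a 0 k < x 0 k < b 0 k] =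
  (\prod_(k < d) (b 0 k - a 0 k))%:E.
Proof.
move=> ab; rewrite -lebesgue_tuple_box// /lebesgue_Rd /pushforward.
by congr (lebesgue_tuple d _); apply/seteqP; split => x /= H k;
  move: (H k); rewrite mxE.
Qed.

Lemma open_measurable_Rd d (A : set 'rV[R]_d) :
  open A -> measurable (A : set (borelRd d)).
Proof. exact: sub_sigma_algebra. Qed.

(* Lebesgue measure restricted to the open set [Omega]: functions on [Omega]
   are represented by functions on R^d that are considered up to equality almost
   everywhere for this measure. *)
Definition lebesgue_on d (Omega : set 'rV[R]_d) (oOmega : open Omega) :
    {measure set (borelRd d) -> \bar R} :=
  mrestr (@lebesgue_Rd d) (open_measurable_Rd oOmega).

End lebesgue_Rd.

Section dual_space.
Context {R : realType} {U : completeNormedModType R}.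
Implicit Types phi psi : U -> R.

Definition dual phi := scalar phi /\ continuous phi.

Definition dual_norm phi := sup [set `|phi u| | u in [set u : U | `|u| <= 1]].

Definition bidual (Phi : (U -> R) -> R) :=
  (forall a phi psi, dual phi -> dual psi ->
     Phi (fun u => a * phi u + psi u) = a * Phi phi + Phi psi) /\
  (exists M, forall phi, dual phi -> `|Phi phi| <= M * dual_norm phi).

Definition reflexive_space := forall Phi, bidual Phi ->
  exists u : U, forall phi, dual phi -> Phi phi = phi u.

Definition bounded_to_dual (A : U -> U -> R) :=
  [/\ forall u, dual (A u),
      forall a u1 u2 v, A (a *: u1 + u2) v = a * A u1 v + A u2 v
    & exists M, forall u, dual_norm (A u) <= M * `|u|].

Definition has_bounded_inverse (A : U -> U -> R) :=
  exists Ainv : (U -> R) -> U,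
    [/\ forall u, Ainv (A u) = u,
        forall phi, dual phi -> A (Ainv phi) = phi
      & exists M, forall phi, dual phi -> `|Ainv phi| <= M * dual_norm phi].

End dual_space.

Section control_problem.
Context {R : realType} {d : nat} {Omega : set 'rV[R]_d}.
Variable oOmega : open Omega.
Local Notation mu := (lebesgue_on oOmega).
Local Notation fct := (@borelRd R d -> R).
Implicit Types (f g w : fct) (phi : 'rV[R]_d -> 'rV[R]_d).

Definition Lp_norm (p : \bar R) f : \bar R := 'N[mu]_p[EFin \o f]%E.

Definition ae_le f g := {ae mu, forall x, f x <= g x}.

Definition ae_eq_fct f g := {ae mu, forall x, f x = g x}.

Definition partial (g : 'rV[R]_d -> R) (i : 'I_d) (x : 'rV[R]_d) : R :=
  'D_(delta_mx 0 i) g x.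

Definition C1 (g : 'rV[R]_d -> R) := forall i : 'I_d,
  (forall x, derivable g x (delta_mx 0 i)) /\ continuous (partial g i).

Definition supp phi : set 'rV[R]_d := closure [set x | phi x != 0].

Definition divergence phi (x : 'rV[R]_d) : R :=
  \sum_(i < d) partial (fun y => phi y 0 i) i x.

(* The sum of squares is the Euclidean norm; the norm of the library on row
   vectors is the maximum norm. *)
Definition TV_test : set ('rV[R]_d -> 'rV[R]_d) := [set phi : 'rV[R]_d -> 'rV[R]_d |
  [/\ forall i, C1 (fun x => phi x 0 i),
      compact (supp phi), supp phi `<=` Omega
    & forall x, \sum_(i < d) (phi x 0 i) ^+ 2 <= 1]].

Definition TV w : \bar R :=
  ereal_sup [set (\int[mu]_x (w x * divergence phi x)%:E)%E | phi in TV_test].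

Definition BV w := w \in Lfun mu 1%E /\ (TV w < +oo)%E.

Definition lsc_L1 (F : fct -> \bar R) :=
  forall w, w \in Lfun mu 1%E -> forall a : R, (a%:E < F w)%E ->
  exists2 eps : R, 0 < eps & forall g, g \in Lfun mu 1%E ->
    (Lp_norm 1 (g \- w)%R < eps%:E)%E -> (a%:E < F g)%E.

Definition in_L2 (C : set fct) := forall w, C w -> w \in Lfun mu 2%:E.

Definition bounded_L2 (C : set fct) :=
  exists M : R, forall w, C w -> (Lp_norm 2%:E w <= M%:E)%E.

Definition closed_L2 (C : set fct) := forall w, w \in Lfun mu 2%:E ->
  (forall eps : R, 0 < eps ->
    exists2 g, C g & (Lp_norm 2%:E (g \- w)%R < eps%:E)%E) -> C w.

Definition convex_fct (C : set fct) := forall f g (t : R), C f -> C g ->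
  0 <= t <= 1 -> C (fun x => t * f x + (1 - t) * g x).

Section state.
Context {U : completeNormedModType R}.
(* [e u] represents the image of [u : U] in L^2(Omega). *)
Variable e : U -> fct.

Definition compact_embedding :=
  [/\ forall u, e u \in Lfun mu 2%:E,
      forall a u v, ae_eq_fct (e (a *: u + v)) (fun x => a * e u x + e v x),
      forall u, ae_eq_fct (e u) (cst 0) -> u = 0
    & forall u_ : nat -> U, (exists M, forall n, `|u_ n| <= M) ->
      exists2 k : nat -> nat, {homo k : m n / (m < n)%N} &
      exists2 g, g \in Lfun mu 2%:E &
        (Lp_norm 2%:E (e (u_ (k n)) \- g)%R @[n --> \oo] --> 0%E)].

(* The functional v |-> (g, v)_{L^2}, through which functions act on [U]; for g
   in L^2(Omega) it is the embedding of H = H^* into U^*. *)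
Definition to_dual g : U -> R := fun v => \int[mu]_x (g x * e v x).

(* g is an element of U^*: it acts on [U] through an absolutely convergent
   integral, and continuously. *)
Definition in_dual g :=
  (forall v, mu.-integrable setT (fun x => (g x * e v x)%:E)) /\
  dual (to_dual g).

Definition dual_embedding := forall g, g \in Lfun mu 2%:E ->
  (forall v, to_dual g v = 0) -> ae_eq_fct g (cst 0).

(* A u + g = f in U^* *)
Definition state_eq (A : U -> U -> R) (f : U -> R) (u : U) g :=
  forall v, A u v + to_dual g v = f v.

Definition Lipschitz_on_bounded (j : U -> fct -> R) :=
  forall r : R, exists L : R, forall u1 u2 w1 w2,
    `|u1| <= r -> `|u2| <= r ->
    w1 \in Lfun mu 2%:E -> (Lp_norm 2%:E w1 <= r%:E)%E ->
    w2 \in Lfun mu 2%:E -> (Lp_norm 2%:E w2 <= r%:E)%E ->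
    (`|j u1 w1 - j u2 w2|%:E <=
       L%:E * (`|u1 - u2|%:E + Lp_norm 2%:E (w1 \- w2)%R))%E.

Definition Lipschitz_snd_on (C : set fct) (j : U -> fct -> R) (u : U) (L : R) :=
  forall w1 w2, C w1 -> C w2 ->
    (`|j u w1 - j u w2|%:E <= L%:E * Lp_norm 2%:E (w1 \- w2)%R)%E.

End state.

(* Up to its boundary, [Q] is a cube with edge length [l]; which faces belong
   to [Q] is left open, so that a partition in the strict sense is possible. *)
Definition is_cube (Q : set 'rV[R]_d) (a : 'rV[R]_d) (l : R) :=
  [/\ 0 < l, measurable (Q : set (@borelRd R d)),
      [set x : 'rV[R]_d | forall k, a 0 k < x 0 k < a 0 k + l] `<=` Q
    & Q `<=` [set x : 'rV[R]_d | forall k, a 0 k <= x 0 k <= a 0 k + l]].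

Definition cube_partition N (Q : 'I_N -> set 'rV[R]_d) (h : R) :=
  [/\ trivIset setT Q, \bigcup_i Q i = Omega &
      exists a l, (forall i, is_cube (Q i) (a i) (l i)) /\
                  h = \big[Num.max/0]_(i < N) l i].

Section discretization.
Context {N : nat} (Q : 'I_N -> set 'rV[R]_d).

Definition cell_avg g (i : 'I_N) : R :=
  (fine (mu (Q i)))^-1 * \int[mu]_(x in Q i) g x.

Definition step_fct (c : 'rV[R]_N) : fct :=
  fun x => \sum_(i < N) c 0 i * \1_(Q i) x.

Definition avg g : fct := step_fct (\row_i cell_avg g i).

End discretization.

Record cell_bounds N := CellBounds {
  u_lo : 'I_N -> R; u_up : 'I_N -> R; w_lo : 'I_N -> R; w_up : 'I_N -> R }.

Definition set_u_lo N (b : cell_bounds N) (i : 'I_N) (m : R) : cell_bounds N :=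
  CellBounds (fun k => if k == i then m else u_lo b k) (u_up b) (w_lo b) (w_up b).

Definition set_u_up N (b : cell_bounds N) (i : 'I_N) (m : R) : cell_bounds N :=
  CellBounds (u_lo b) (fun k => if k == i then m else u_up b k) (w_lo b) (w_up b).

Definition McCormick N (b : cell_bounds N) (i : 'I_N) (pu pw z : R) :=
  [/\ z >= u_lo b i * pw + pu * w_lo b i - u_lo b i * w_lo b i,
      z >= u_up b i * pw + pu * w_up b i - u_up b i * w_up b i,
      z <= u_up b i * pw + pu * w_lo b i - u_up b i * w_lo b i,
      z <= u_lo b i * pw + pu * w_up b i - u_lo b i * w_up b i
    & u_lo b i <= pu <= u_up b i].

Definition admissible (C : set fct) (wl wu : fct) w :=
  [/\ C w, ae_le wl w & ae_le w wu].

Section McC.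
Context {U : completeNormedModType R} (e : U -> fct) (A : U -> U -> R)
  (f : U -> R) (j : U -> fct -> R) (alpha : R) (C : set fct) (wl wu : fct)
  (N : nat) (Q : 'I_N -> set 'rV[R]_d).

Definition averaged_state_eq (u : U) w :=
  state_eq e A f u (avg Q (e u) \* avg Q w).

Definition McCh_feasible (b : cell_bounds N) : set (U * fct * 'rV[R]_N) :=
  [set p | let: (u, w, z) := p in
    [/\ admissible C wl wu w, state_eq e A f u (step_fct Q z)
      & forall i, McCormick b i (cell_avg Q (e u) i) (cell_avg Q w i) (z 0 i)]].

Definition McCh_objective (u : U) w : \bar R :=
  ((j u w)%:E + alpha%:E * TV w)%E.

Definition McCh_minimizer (b : cell_bounds N) (p : U * fct * 'rV[R]_N) :=
  McCh_feasible b p /\ forall q, McCh_feasible b q ->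
    (McCh_objective p.1.1 p.1.2 <= McCh_objective q.1.1 q.1.2)%E.

Definition McChh_feasible (b : cell_bounds N) :
    set (U * 'rV[R]_N * 'rV[R]_N) :=
  [set p | let: (u, w, z) := p in
    [/\ admissible C wl wu (step_fct Q w), state_eq e A f u (step_fct Q z)
      & forall i, McCormick b i (cell_avg Q (e u) i) (w 0 i) (z 0 i)]].

Definition McChh_value (TVh : fct -> \bar R) (b : cell_bounds N) : \bar R :=
  ereal_inf [set ((j p.1.1 (step_fct Q p.1.2))%:E +
                  alpha%:E * TVh (step_fct Q p.1.2))%E
            | p in McChh_feasible b].

Definition cell_values (b : cell_bounds N) (i : 'I_N) : set R :=
  [set cell_avg Q (e p.1.1) i | p in McChh_feasible b].

(* The minimum or the maximum has to be attained: the first conjunct. *)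
Definition OBBT_step (b b' : cell_bounds N) := exists (i : 'I_N) (m : R),
  cell_values b i m /\
  (lbound (cell_values b i) m /\ b' = set_u_lo b i m \/
   ubound (cell_values b i) m /\ b' = set_u_up b i m).

End McC.
End control_problem.

Arguments reflexive_space {R} U.
Arguments cube_partition {R d} Omega {N} Q h.
Arguments cell_bounds R N : clear implicits.

(* Main.v *)
From HB Require Import structures.
Require Import Defs.
From mathcomp Require Import all_boot all_order all_algebra.
From mathcomp Require Import all_classical all_reals all_analysis.
From mathcomp Require Import measurable_realfun ess_sup_inf.
From mathcomp Require Import lra ring.
Import Order.TTheory GRing.Theory Num.Theory.
Import numFieldNormedType.Exports.
Local Open Scope classical_set_scope.
Local Open Scope ring_scope.
Set Implicit Arguments.
Unset Strict Implicit.
Unset Printing Implicit Defensive.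

(** The proof compares the minimizer of the partially discretized problem with
    its cell averages.

    Lower bound.  Let [w] be the given control, [Pw] its cell averages and [u]
    the state for the averaged equation.  The values of [Pu] and [Pw] satisfy the a
    priori bounds on every cell, so their exact product satisfies the McCormick
    inequalities and [(u, Pw, Pu Pw)] is feasible; tightening preserves this
    point, because a minimum or maximum over a feasible set cannot exclude the cell
    value of one of its elements ([averaged_feasible], [OBBT_keeps_cell_value]).
    Hence the discrete optimal value is at most j(u, Pw) + alpha TV_h(Pw), where
    TV_h(Pw) is at most TV(w), and the Lipschitz continuity of [j] leaves the norm of
    [w - Pw] in L^2.  Since [w] and [Pw] both lie between the two control bounds,
    the squared norm is at most the maximal distance of these bounds times the
    norm of [w - Pw] in L^1 ([Lnorm2_le_interpolation]), and the latter is at most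
    sqrt d h TV(w) by a Poincare inequality ([partition_poincare]).

    Poincare inequality.  The total variation is a supremum over test fields, so
    a field whose divergence is close to the sign of [w - Pw] minus its mean is needed
    on each cube.  The set where [w - Pw] is nonnegative is approximated by
    unions of boxes of a dyadic grid ([grid_set_approx]).  For a sign pattern [g] on a
    grid, one averages out one variable after the other; each step is the
    derivative, along one axis, of a function of size at most the edge length, and
    the steps add up to [g] minus its mean.  With smoothed indicators of
    intervals in place of indicators this is an explicit continuously
    differentiable field with compact support in the open cube
    ([cube_field_divergence], [cube_field_bound]), and dominated convergence removes the
    smoothing ([grid_field_cvg]).  The fields of different cubes have disjoint
    supports, so their sum is again a test field.

    Monotonicity.  The feasible sets decrease: the McCormick inequalities for a
    tightened interval imply the original ones, provided that the control value lies
    between its bounds ([feasible_OBBT_step]).  This is where step functions on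
    cubes have to be functions of bounded variation ([BV_step_fct]): then the
    averaged equation has a solution for them and the a priori bounds apply.  The
    bound on their variation comes from translation invariance of Lebesgue
    measure, which turns the integral of a difference quotient over a box into
    integrals over two thin slabs ([partial_box_bound]). *)

(** * Boxes and their faces *)

Lemma negligible_bigcup_fin d (T : measurableType d) (R : realType)
    (mu : {measure set T -> \bar R}) (I : finType) (F : I -> set T) :
  (forall i, mu.-negligible (F i)) -> mu.-negligible (\bigcup_i F i).
Proof.
move=> nF; pose G n := if unpickle n is Some i then F i else set0.
apply: (@negligibleS _ _ _ _ (\bigcup_n G n)).
  by move=> x [i _ Fix]; exists (pickle i) => //; rewrite /G pickleK.
by apply: negligible_bigcup => n; rewrite /G; case: unpickle => // *; exact: negligible_set0.
Qed.

Section boxes.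
Context {R : realType} {d : nat}.
Local Notation L := (@lebesgue_Rd R d).
Implicit Types (a b : 'rV[R]_d).

Definition box a b : set (@borelRd R d) :=
  [set x : 'rV[R]_d | forall k, a 0 k < x 0 k < b 0 k].

Definition cbox a b : set (@borelRd R d) :=
  [set x : 'rV[R]_d | forall k, a 0 k <= x 0 k <= b 0 k].

Lemma continuous_measurable_Rd (f : 'rV[R]_d -> R) :
  continuous f -> measurable_fun [set: @borelRd R d] (f : borelRd d -> R).
Proof.
move=> /continuousP cf.
apply: (measurability _ (RGenOpens.measurableE R)) => _ [_ [a [b ->]]] <-.
rewrite setTI; apply: open_measurable_Rd; apply: cf.
exact: interval_open.
Qed.

Lemma coord_continuous_rV (k : 'I_d) : continuous (fun x : 'rV[R]_d => x 0 k).
Proof. exact: coord_continuous. Qed.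

Lemma measurable_coord (k : 'I_d) :
  measurable_fun [set: @borelRd R d] (fun x : borelRd d => (x : 'rV[R]_d) 0 k).
Proof. by apply: continuous_measurable_Rd; exact: coord_continuous_rV. Qed.

Lemma measurable_coord_set (k : 'I_d) (A : set R) : measurable A ->
  measurable ([set x : 'rV[R]_d | A (x 0 k)] : set (borelRd d)).
Proof.
by move=> mA; rewrite -[X in measurable X]setTI; apply: (measurable_coord k).
Qed.

Lemma measurable_coords_set (A : 'I_d -> set R) : (forall k, measurable (A k)) ->
  measurable ([set x : 'rV[R]_d | forall k, A k (x 0 k)] : set (borelRd d)).
Proof.
move=> mA; rewrite (_ : [set _ | _] = \bigcap_(k in [set: 'I_d]) [set x : 'rV[R]_d | A k (x 0 k)]); last first.
  by apply/seteqP; split => [x Ax k _|x Ax k]; exact: Ax.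
apply: fin_bigcap_measurable; first exact: finite_finset.
by move=> k _; exact: (measurable_coord_set k (mA k)).
Qed.

Lemma measurable_box a b : measurable (box a b).
Proof.
have := @measurable_coords_set (fun k => `]a 0 k, b 0 k[%classic).
rewrite (_ : [set _ | _] = box a b); last first.
  by apply/seteqP; split=> x xab k; have := xab k; rewrite /= in_itv.
by apply => k; exact: measurable_itv.
Qed.

Lemma measurable_cbox a b : measurable (cbox a b).
Proof.
have := @measurable_coords_set (fun k => `[a 0 k, b 0 k]%classic).
rewrite (_ : [set _ | _] = cbox a b); last first.
  by apply/seteqP; split=> x xab k; have := xab k; rewrite /= in_itv.
by apply => k; exact: measurable_itv.
Qed.

Lemma closed_cbox a b : closed (cbox a b : set 'rV[R]_d).
Proof.
rewrite (_ : cbox a b = \bigcap_(k in [set: 'I_d])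
    ((fun x : 'rV[R]_d => x 0 k) @^-1` `[a 0 k, b 0 k]%classic)).
  apply: closed_bigI => k _; apply: closed_comp; last exact: interval_closed.
  by move=> x _; exact: coord_continuous_rV.
apply/seteqP; split => [x xab k _|x xab k]; first by rewrite /= in_itv; exact: xab.
by have := xab k I; rewrite /= in_itv.
Qed.

Lemma compact_cbox a b : compact (cbox a b : set 'rV[R]_d).
Proof.
rewrite (_ : cbox a b =
  [set x : 'rV[R]_d | forall k, `[a 0 k, b 0 k]%classic (x 0 k)]).
  by apply: (@rV_compact _ _ (fun k => `[a 0 k, b 0 k]%classic)) => k; exact: segment_compact.
by apply/seteqP; split => x xab k; have := xab k; rewrite /= in_itv.
Qed.

(** A face has measure zero because it lies in boxes of arbitrarily small width
    in direction [k]. *)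
Lemma lebesgue_face a b (k : 'I_d) (c : R) :
  L (cbox a b `&` [set x : 'rV[R]_d | x 0 k = c]) = 0%E.
Proof.
set F := (X in L X).
have mF : measurable F.
  by apply: measurableI; [exact: measurable_cbox|exact: (@measurable_coord_set k [set c])].
have [->|/set0P[x0 Fx0]] := eqVneq F set0; first by rewrite measure0.
have ab i : a 0 i <= b 0 i.
  by have [/(_ i)/andP[]] := Fx0 => /le_trans h /h.
pose V := \prod_(i < d | i != k) (b 0 i - a 0 i + 2).
have V0 : 0 <= V.
  by apply: prodr_ge0 => i _; have := ab i; lra.
apply/eqP; rewrite eq_le measure_ge0 andbT; apply/lee_addgt0Pr => e e0.
rewrite add0e.
pose t := e / (2 * (V + 1)).
have t0 : 0 < t by rewrite divr_gt0// mulr_gt0// ltr_wpDl.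
pose a' : 'rV[R]_d := \row_i (if i == k then c - t else a 0 i - 1).
pose b' : 'rV[R]_d := \row_i (if i == k then c + t else b 0 i + 1).
apply: (@le_trans _ _ (L (box a' b'))).
  apply: le_measure; rewrite ?inE//; first exact: measurable_box.
  move=> x [xab xc] i; rewrite !mxE; case: eqP => [->|_]; first by rewrite xc; lra.
  by have /andP[] := xab i; lra.
rewrite lebesgue_Rd_box => [|i]; last first.
  by rewrite !mxE; case: eqP => _; [lra|have := ab i; lra].
rewrite lee_fin (bigD1 k)//= !mxE eqxx.
rewrite (eq_bigr (fun i => b 0 i - a 0 i + 2)) => [|i /negPf ik]; last first.
  by rewrite !mxE ik; ring.
rewrite -/V (_ : c + t - (c - t) = 2 * t); last by ring.
rewrite (_ : 2 * t * V = e * (V / (V + 1))); last by rewrite /t; field; lra.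
by rewrite ler_piMr ?ltW// ltr_pdivrMr ?mul1r; lra.
Qed.

Lemma lebesgue_cbox_lty a b : (L (cbox a b) < +oo)%E.
Proof.
have [->|/set0P[x0 Fx0]] := eqVneq (cbox a b) set0; first by rewrite measure0.
have ab i : a 0 i <= b 0 i.
  by have /andP[] := Fx0 i => /le_trans h /h.
pose a' : 'rV[R]_d := \row_i (a 0 i - 1).
pose b' : 'rV[R]_d := \row_i (b 0 i + 1).
apply: (@le_lt_trans _ _ (L (box a' b'))).
  apply: le_measure; rewrite ?inE//.
  - exact: measurable_cbox.
  - exact: measurable_box.
  by move=> x xab i; rewrite !mxE; have := xab i; lra.
rewrite lebesgue_Rd_box ?ltry// => i.
by rewrite !mxE; have := ab i; lra.
Qed.

Lemma lebesgue_box_lty a b : (L (box a b) < +oo)%E.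
Proof.
apply: le_lt_trans (lebesgue_cbox_lty a b); apply: le_measure; rewrite ?inE//.
- exact: measurable_box.
- exact: measurable_cbox.
by move=> x xab k; have := xab k; lra.
Qed.

Lemma negligible_faces a b :
  L.-negligible (cbox a b `\` box a b).
Proof.
pose F (k : 'I_d) (c : R) := cbox a b `&` [set x : 'rV[R]_d | x 0 k = c].
have nF k c : L.-negligible (F k c).
  exists (F k c); split => //; last exact: lebesgue_face.
  apply: measurableI; first exact: measurable_cbox.
  exact: (@measurable_coord_set k [set c]).
apply: (@negligibleS _ _ _ _ (\bigcup_k (F k (a 0 k) `|` F k (b 0 k)))).
  move=> x [xab]; rewrite /box/= => /existsNP[k] /negP.
  have := xab k; rewrite negb_and -!leNgt => /andP[h2 h3] /orP[] h1;
    exists k => //; [left|right]; split => //=; lra.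
by apply: negligible_bigcup_fin => k; exact: negligibleU.
Qed.
End boxes.

(** * Translation invariance of Lebesgue measure *)

Section translation.
Context {R : realType} {d : nat}.
Local Notation L := (@lebesgue_Rd R d).
Implicit Types (a b : 'rV[R]_d).

Definition boxes : set (set (@borelRd R d)) :=
  [set B | exists a b : 'rV[R]_d, B = box a b].

Lemma setI_closed_boxes : setI_closed boxes.
Proof.
move=> _ _ [a [b ->]] [a' [b' ->]].
exists (\row_k Num.max (a 0 k) (a' 0 k)), (\row_k Num.min (b 0 k) (b' 0 k)).
apply/seteqP; split => [x [h h'] k|x h].
  by rewrite !mxE gt_max lt_min; have /andP[-> ->] := h k; have /andP[-> ->] := h' k.
by split => k; have := h k; rewrite !mxE gt_max lt_min => /andP[/andP[? ?] /andP[? ?]]; apply/andP.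
Qed.

Lemma open_bigcup_boxes (A : set 'rV[R]_d) : open A ->
  A = \bigcup_(p in [set p : 'rV[rat]_d * nat |
        box (\row_k (ratr (p.1 0 k) - p.2.+1%:R^-1))
            (\row_k (ratr (p.1 0 k) + p.2.+1%:R^-1)) `<=` A])
      box (\row_k (ratr (p.1 0 k) - p.2.+1%:R^-1))
          (\row_k (ratr (p.1 0 k) + p.2.+1%:R^-1)).
Proof.
move=> oA; apply/seteqP; split => x /=; last by move=> [p + xp]; exact.
move=> Ax; have /nbhs_ballP[e /= e0 eA] : nbhs x A by exact: open_nbhs_nbhs.
have e20 : 0 < e / 2 by rewrite divr_gt0.
have [k _ /(_ k (leqnn k)) /= ke] := near_infty_natSinv_lt (PosNum e20).
have k0 : (0 : R) < k.+1%:R^-1 by rewrite invr_gt0.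
have /choice[q xq] : forall i, exists q : rat,
    x 0 i - k.+1%:R^-1 < (ratr q : R) < x 0 i.
  move=> i; have [|q] := @rat_in_itvoo R (x 0 i - k.+1%:R^-1) (x 0 i).
    by rewrite ltrBlDr ltrDl.
  by rewrite in_itv/= => ?; exists q.
exists (\row_i q i, k) => /=.
  move=> y yq; apply: eA; split => // i j.
  rewrite (ord1 i) /ball /= ltr_distlC; have := yq j; have := xq j; rewrite !mxE /=.
  move: ke => /=; move: (_^-1) => ik; lra.
by move=> i; have := xq i; rewrite !mxE; move: k0; move: (_.+1%:R^-1) => ik; lra.
Qed.

Lemma borelRd_boxes : @measurable _ (@borelRd R d) = <<s boxes >>.
Proof.
apply/seteqP; split; last first.
  apply: smallest_sub; first exact: sigma_algebra_measurable.
  by move=> _ [a [b ->]]; exact: measurable_box.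
apply: smallest_sub; first exact: smallest_sigma_algebra.
move=> A oA; rewrite (open_bigcup_boxes oA) bigcup_mkcond.
apply: (@countable_bigcupT_measurable _ (g_sigma_algebraType boxes)) => // p.
case: ifP => // _; apply: sub_sigma_algebra; eexists; eexists; reflexivity.
Qed.

(** Two measures that agree on bounded boxes are equal, so that Lebesgue measure
    inherits the translation invariance of the volume of boxes. *)
Lemma lebesgue_Rd_translate (v : 'rV[R]_d) (A : set (@borelRd R d)) :
  measurable A ->
  pushforward L (fun x : borelRd d => (x : 'rV[R]_d) + v : borelRd d) A = L A.
Proof.
pose T (x : @borelRd R d) : @borelRd R d := ((x : 'rV[R]_d) + v : 'rV[R]_d).
have Tbox a b : T @^-1` box a b = box (a - v) (b - v).
  by apply/seteqP; split => x h k; have := h k; rewrite !mxE /=; lra.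
have mT : measurable_fun [set: borelRd d] T.
  apply: (measurability boxes); first exact: borelRd_boxes.
  move=> _ [_ [a [b ->]] <-]; rewrite setTI.
  by rewrite Tbox; exact: measurable_box.
pose T' : {mfun borelRd d >-> borelRd d} := HB.pack T (isMeasurableFun.Build _ _ _ _ _ mT).
move=> mA.
apply: (measure_unique boxes (fun n => box (\row_k - n%:R) (\row_k n%:R))
  borelRd_boxes setI_closed_boxes _ _ (pushforward L T') L) => //.
- by move=> n; eexists; eexists; reflexivity.
- apply/seteqP; split => // x _.
  have [n _ xn] : exists2 n : nat, True & `|x : 'rV[R]_d| < n%:R.
    by exists (Num.truncn `|x : 'rV[R]_d|).+1 => //; exact: truncnS_gt.
  exists n => // k; rewrite !mxE -ltr_norml; apply: le_lt_trans xn.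
  rewrite [leRHS]mx_normrE; exact: (le_bigmax _ (fun i : 'I_1 * 'I_d => `|(x : 'rV[R]_d) i.1 i.2|) (0, k)).
- move=> _ [a [b ->]]; transitivity (L (T @^-1` box a b)) => //.
  rewrite Tbox.
  have [ab|/existsNP[k /negP]] := pselect (forall k, a 0 k <= b 0 k).
    rewrite lebesgue_Rd_box => [|k]; last by rewrite !mxE; have := ab k; lra.
    apply/esym/(etrans (lebesgue_Rd_box ab)).
    by congr EFin; apply: eq_bigr => k _; rewrite !mxE; ring.
  rewrite -ltNge => ba.
  have e0 (a' b' : 'rV[R]_d) : b' 0 k < a' 0 k -> box a' b' = set0.
    by move=> h; apply/seteqP; split => // x /(_ k); lra.
  suff -> : box (a - v) (b - v) = box a b by [].
  by rewrite [RHS]e0// e0// !mxE; lra.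
- move=> n; rewrite [ltLHS](_ : _ = L (T @^-1` box (\row_k - n%:R) (\row_k n%:R)))//.
  by rewrite Tbox; exact: lebesgue_box_lty.
Qed.

End translation.

(** * Functions with continuous partial derivatives *)

Section partial_calculus.
Context {R : realType} {d : nat}.
Local Notation ee := (delta_mx 0 : 'I_d -> 'rV[R]_d).
Implicit Types (x y : 'rV[R]_d) (f g : 'rV[R]_d -> R) (k : 'I_d).

Lemma continuous_sum_fct (I : Type) (s : seq I) (F : I -> 'rV[R]_d -> R) :
  (forall i, continuous (F i)) -> continuous (fun x => \sum_(i <- s) F i x).
Proof.
move=> cF; elim: s => [|i s IH].
  by under eq_fun do rewrite big_nil; exact: cst_continuous.
under eq_fun do rewrite big_cons.
move=> x; apply: (@continuousD _ _ _ (F i) (fun x => \sum_(i <- s) F i x) x).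
  exact: cF.
exact: IH.
Qed.

Lemma is_derive_line f k x (s : R) :
  derivable f (x + s *: ee k) (ee k) ->
  is_derive s 1 (fun t : R => f (x + t *: ee k)) (partial f k (x + s *: ee k)).
Proof.
have E : (fun h : R => h^-1 *: (((fun t : R => f (x + t *: ee k)) \o shift s) (h *: 1)
            - f (x + s *: ee k))) =
   (fun h : R => h^-1 *: ((f \o shift (x + s *: ee k)) (h *: ee k) - f (x + s *: ee k))).
  apply/funext => h /=; congr (_ *: (f _ - _)).
  by rewrite [h *: 1]mulr1 scalerDl addrCA.
by move=> df; split; rewrite /derivable /derive /partial E.
Qed.

Lemma partial_MVT f k x (t : R) : (forall y, derivable f y (ee k)) ->
  exists2 c, `|c| <= `|t| & f (x + t *: ee k) - f x = partial f k (x + c *: ee k) * t.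
Proof.
move=> df; pose g (s : R) := f (x + s *: ee k).
have dg (s : R) : is_derive s (1 : R) g (partial f k (x + s *: ee k)) by exact: is_derive_line.
have cg : continuous g.
  by move=> s; apply/differentiable_continuous/derivable1_diffP; case: (dg s).
have -> : f x = g 0 by rewrite /g scale0r addr0.
rewrite -/(g t).
have [t0|t0] := leP 0 t.
  have [|c] := @MVT_segment R g (fun s => partial f k (x + s *: ee k)) 0 t t0 (fun s _ => dg s).
    exact: continuous_subspaceT.
  rewrite in_itv/= => /andP[c0 ct] gt0; exists c; last by rewrite gt0 subr0.
  by rewrite !ger0_norm.
have [|c] := @MVT_segment R g (fun s => partial f k (x + s *: ee k)) t 0 (ltW t0) (fun s _ => dg s).
  exact: continuous_subspaceT.
rewrite in_itv/= => /andP[c0 ct] gt0; exists c; last by rewrite -[LHS]opprB gt0; ring.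
by rewrite !ler0_norm ?lerN2// ltW.
Qed.

Lemma continuous_cbox_bounded f (a b : 'rV[R]_d) : continuous f ->
  exists2 M : R, 0 <= M & forall x, cbox a b x -> `|f x| <= M.
Proof.
move=> cf.
have /compact_bounded[M [_ HM]] : compact (f @` cbox a b).
  by apply: continuous_compact; [exact: continuous_subspaceT|exact: compact_cbox].
exists (`|M| + 1); first by rewrite addr_ge0.
move=> x xab; apply: (HM (`|M| + 1)); last by exists x.
by rewrite (le_lt_trans (ler_norm _))// ltrDl.
Qed.

(** The increment is the sum of increments along the coordinate axes, each of
    which is controlled by the mean value theorem. *)
Lemma C1_continuous f : C1 f -> continuous f.
Proof.
move=> C1f x.
pose a : 'rV[R]_d := x - const_mx 1; pose b : 'rV[R]_d := x + const_mx 1.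
have /choice[M MP] : forall k : 'I_d, exists M : R, 0 <= M /\ forall y, cbox a b y -> `|partial f k y| <= M.
  by move=> k; have [M M0 HM] := continuous_cbox_bounded a b (C1f k).2; exists M.
pose S := \sum_k M k.
have S0 : 0 <= S by apply: sumr_ge0 => k _; have [] := MP k.
pose z y (m : nat) : 'rV[R]_d := \row_i (if (i < m)%N then y 0 i else x 0 i).
have zS y m (md : (m < d)%N) :
    z y m.+1 = z y m + (y 0 (Ordinal md) - x 0 (Ordinal md)) *: ee (Ordinal md).
  apply/rowP => i; rewrite !mxE eqxx/= ltnS leq_eqVlt -val_eqE /=.
  have [im|im]/= := eqVneq (val i) m.
    have -> : i = Ordinal md by exact: val_inj.
    by rewrite ltnn mulr1 addrC subrK.
  by rewrite mulr0 addr0.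
have inc y (r : R) : 0 <= r -> r <= 1 -> (forall k, `|y 0 k - x 0 k| <= r) ->
    `|f y - f x| <= S * r.
  move=> r0 r1 yx.
  have -> : f y = f (z y d) by congr f; apply/rowP => i; rewrite mxE ltn_ord.
  have -> : f x = f (z y 0%N) by congr f; apply/rowP => i; rewrite mxE.
  rewrite -[f (z y d) - f _](telescope_sumr (fun m => f (z y m)) (leq0n d)) big_mkord.
  rewrite (le_trans (ler_norm_sum _ _ _))// /S mulr_suml ler_sum// => k _.
  have := zS y k (ltn_ord k); rewrite (_ : Ordinal (ltn_ord k) = k); last exact: val_inj.
  move=> ->; have [c ct ->] := @partial_MVT f k (z y k) (y 0 k - x 0 k) (C1f k).1.
  rewrite normrM ler_pM//; apply: (MP k).2 => i; rewrite !mxE.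
  have cr : `|c| <= 1 by apply: le_trans r1; apply: le_trans ct _.
  have /ler_normlP[] := cr; have /ler_normlP[] := le_trans (yx i) r1.
  rewrite eqxx /=; case: ltnP => ik; case: eqP => [ek|_]; rewrite ?mulr1 ?mulr0;
    try by move: ik; rewrite ek ltnn.
  - by move=> *; lra.
  - by move=> *; lra.
  - by move=> *; lra.
apply/(@cvgrPdist_le _ _ _ (nbhs x) (nbhs_filter x) f (f x)) => e e0.
pose r := Num.min 1 (e / (S + 1)).
have S1 : 0 < S + 1 by rewrite ltr_wpDl.
have r0 : 0 < r by rewrite lt_min ltr01 divr_gt0.
apply/nbhs_ballP; exists r => //= y [_ xy].
rewrite distrC; apply: (@le_trans _ _ (S * r)).
  apply: inc; [exact: ltW|by rewrite ge_min lexx|].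
  by move=> k; have := xy 0 k; rewrite /ball /= distrC; exact: ltW.
have : r <= e / (S + 1) by rewrite ge_min lexx orbT.
rewrite ler_pdivlMr//; apply: le_trans.
by rewrite mulrC ler_wpM2l ?ltW// ltrDl.
Qed.

End partial_calculus.

(** * The integral of a partial derivative over a box *)

Lemma cvg_Rintegral_bounded d (T : measurableType d) (R : realType)
    (mu : {measure set T -> \bar R}) (D : set T) (w : T -> R)
    (f_ : nat -> T -> R) (f : T -> R) (M : R) : measurable D ->
  mu.-integrable D (EFin \o w) -> (forall n, measurable_fun D (f_ n)) ->
  measurable_fun D f -> (forall n x, D x -> `|f_ n x| <= M) ->
  {ae mu, forall x, D x -> f_ ^~ x @ \oo --> f x} ->
  \int[mu]_(x in D) (w x * f_ n x) @[n --> \oo] --> \int[mu]_(x in D) (w x * f x).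
Proof.
move=> mD iw mf_ mf fM ff; have mw := measurable_int _ iw.
have mw' : measurable_fun D w by apply/measurable_EFinP.
have [| | | | |fi _] := @dominated_convergence _ _ _ mu D mD
  (fun n x => (w x * f_ n x)%:E) (fun x => (w x * f x)%:E) (fun x => (M%:E * `|(w x)%:E|)%E).
- by move=> n; apply/measurable_EFinP/measurable_funM.
- exact/measurable_EFinP/measurable_funM.
- apply: filterS ff => x fx Dx; apply: cvg_EFin; first exact: nearW.
  by apply: cvgMl_tmp; exact: fx.
- exact/integrableZl/integrable_abse.
- apply: aeW => x n Dx; rewrite /= lee_fin normrM mulrC.
  by rewrite ler_wpM2r// fM.
have -> : (\int[mu]_(x in D) (w x * f x)%:E = (\int[mu]_(x in D) (w x * f x))%R%:E)%E.
  by rewrite /Rintegral fineK//; exact: integrable_fin_num.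
by move/fine_cvg.
Qed.

Section integrable_real.
Context d (T : measurableType d) (R : realType) (mu : {measure set T -> \bar R}).
Variables (D : set T) (mD : measurable D).
Implicit Types f g : T -> R.

Lemma integrableM_bounded f g (M : R) : mu.-integrable D (EFin \o f) ->
  measurable_fun D g -> (forall x, D x -> `|g x| <= M) ->
  mu.-integrable D (EFin \o (fun x => f x * g x)).
Proof.
move=> fi mg gM; apply: (@integrableMl _ _ _ mu D mD (EFin \o f) g) => //.
by exists M; split; rewrite ?num_real// => r Mr x Dx; apply: le_trans (ltW Mr); exact: gM.
Qed.

Lemma integrableD_real f g : mu.-integrable D (EFin \o f) ->
  mu.-integrable D (EFin \o g) -> mu.-integrable D (EFin \o (fun x => f x + g x)).
Proof. by move=> fi gi; apply: (@integrableD _ _ _ mu D mD (EFin \o f) (EFin \o g)). Qed.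

Lemma integrableB_real f g : mu.-integrable D (EFin \o f) ->
  mu.-integrable D (EFin \o g) -> mu.-integrable D (EFin \o (fun x => f x - g x)).
Proof. by move=> fi gi; apply: (@integrableB _ _ _ mu D mD (EFin \o f) (EFin \o g)). Qed.

Lemma integrableZ_real (k : R) f : mu.-integrable D (EFin \o f) ->
  mu.-integrable D (EFin \o (fun x => k * f x)).
Proof. by move=> fi; apply: (@integrableZl _ _ _ mu D mD k (EFin \o f)). Qed.

Lemma integrable_sum_real (I : Type) (s : seq I) (F : I -> T -> R) :
  (forall i, mu.-integrable D (EFin \o F i)) ->
  mu.-integrable D (EFin \o (fun x => \sum_(i <- s) F i x)).
Proof.
move=> Fi; rewrite [X in mu.-integrable _ X](_ : _ = fun x => (\sum_(i <- s) (EFin \o F i) x)%E).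
  exact: integrable_sum.
by apply/funext => x /=; rewrite sumEFin.
Qed.

End integrable_real.

Section partial_box.
Context {R : realType} {d : nat}.
Local Notation L := (@lebesgue_Rd R d).
Local Notation ee := (delta_mx 0 : 'I_d -> 'rV[R]_d).

Lemma continuous_integrable_box (f : 'rV[R]_d -> R) (a b : 'rV[R]_d) (D : set (borelRd d)) :
  continuous f -> measurable D -> D `<=` box a b ->
  L.-integrable D (EFin \o f).
Proof.
move=> cf mD Dab; apply: measurable_bounded_integrable => //.
- apply: le_lt_trans (lebesgue_box_lty a b).
  by apply: le_measure; rewrite ?inE//; exact: measurable_box.
- by apply: measurable_funTS; exact: continuous_measurable_Rd.
have [M M0 fM] := continuous_cbox_bounded a b cf.
exists M; split; rewrite ?num_real// => r Mr x Dx; apply: le_trans (ltW Mr); apply: fM => k.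
by have := Dab _ Dx k; lra.
Qed.

Lemma normr_Rintegral_le_measure (f : 'rV[R]_d -> R) (a b : 'rV[R]_d) (D : set (borelRd d)) :
  continuous f -> measurable D -> D `<=` box a b -> (forall x, `|f x| <= 1) ->
  `|\int[L]_(x in D) f x| <= fine (L (box a b)).
Proof.
move=> cf mD Dab f1.
have fi := continuous_integrable_box cf mD Dab.
have ci : L.-integrable D (EFin \o cst 1).
  by apply: continuous_integrable_box Dab => //; exact: cst_continuous.
have Dfin : (L D <= L (box a b))%E.
  by apply: le_measure; rewrite ?inE//; exact: measurable_box.
have bfin := lebesgue_box_lty a b.
apply: (le_trans (le_normr_Rintegral mD fi)).
apply: (@le_trans _ _ (\int[L]_(x in D) cst 1 x)).
  apply: le_Rintegral => //; exact: (integrable_norm fi).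
rewrite Rintegral_cst// mul1r fine_le//; rewrite ge0_fin_numE//.
exact: le_lt_trans bfin.
Qed.

(** By translation invariance, the integral of a difference quotient over a box is
    the difference of the integrals of [f] over two thin slabs along the faces
    orthogonal to the [k]-th axis, divided by their thickness. *)
Lemma partial_box_bound (a b : 'rV[R]_d) (k : 'I_d) :
  exists2 K : R, 0 <= K & forall f : 'rV[R]_d -> R, C1 f -> (forall x, `|f x| <= 1) ->
    `|\int[L]_(x in box a b) partial f k x| <= K.
Proof.
have [ab|/existsNP[i /negP]] := pselect (forall i, a 0 i < b 0 i); last first.
  rewrite -leNgt => ba; exists 0 => // f _ _.
  rewrite (_ : box a b = set0) ?Rintegral_set0 ?normr0//.
  by apply/seteqP; split => // x /(_ i); lra.
pose V := \prod_(i < d | i != k) (b 0 i - a 0 i).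
have V0 : 0 <= V by apply: prodr_ge0 => i _; have := ab i; lra.
exists (4 * V); first by lra.
move=> f C1f f1; have cf := C1_continuous C1f.
pose e := ee k.
pose t n : R := n.+1%:R^-1.
have t0 n : 0 < t n by rewrite invr_gt0.
have t1 n : t n <= 1 by rewrite invf_le1// ler1n.
pose B := box a b; have BB : B `<=` box a b by [].
have mB : measurable B := measurable_box a b.
pose T (s : R) (x : @borelRd R d) : @borelRd R d := (x : 'rV[R]_d) + s *: e.
have cT s : continuous (fun x : 'rV[R]_d => x + s *: e).
  move=> x; apply: (@continuousD _ _ _ id (cst (s *: e)) x); first by [].
  exact: cst_continuous.
have cfT s : continuous (fun x : 'rV[R]_d => f (x + s *: e)).
  move=> x; apply: (@continuous_comp _ _ _ (fun x : 'rV[R]_d => x + s *: e) f).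
    exact: cT.
  exact: cf.
have cD0 s : continuous (fun x : 'rV[R]_d => f (x + s *: e) - f x).
  by move=> x; apply: continuousB; [exact: cfT|exact: cf].
pose D n (x : 'rV[R]_d) := (t n)^-1 * (f (x + t n *: e) - f x).
have cD n : continuous (D n).
  move=> x; apply: (@continuousM _ _ (cst (t n)^-1) (fun y : 'rV[R]_d => f (y + t n *: e) - f y) x).
    exact: cst_continuous.
  exact: cD0.
have Tbox s a' b' : T s @^-1` box a' b' = box (a' - s *: e) (b' - s *: e).
  by apply/seteqP; split => x h i; have := h i; rewrite !mxE /=; lra.
have mT s : measurable_fun [set: borelRd d] (T s).
  apply: (measurability boxes); first exact: borelRd_boxes.
  move=> _ [_ [a' [b' ->]] <-]; rewrite setTI.
  by rewrite Tbox; exact: measurable_box.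
have thin (a' b' : 'rV[R]_d) (s : R) : 0 < s -> (forall i, i != k -> a' 0 i = a 0 i /\ b' 0 i = b 0 i) ->
    b' 0 k - a' 0 k = 2 * s -> fine (L (box a' b')) = 2 * s * V.
  move=> s0 h1 h2; rewrite lebesgue_Rd_box => [|i]; last first.
    have [->|ik] := eqVneq i k; first by lra.
    by have [-> ->] := h1 _ ik; rewrite ltW.
  rewrite /= (bigD1 k)//= h2; congr (_ * _); apply: eq_bigr => i ik.
  by have [-> ->] := h1 _ ik.
have DK n : `|\int[L]_(x in B) (cst 1 x * D n x)| <= 4 * V.
  under eq_Rintegral do rewrite mul1r.
  rewrite RintegralZl//; last exact: (continuous_integrable_box (cD0 (t n)) mB BB).
  rewrite normrM gtr0_norm ?invr_gt0// ler_pdivrMl//.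
  rewrite RintegralB//; [|exact: (continuous_integrable_box (cfT (t n)) mB BB)|exact: (continuous_integrable_box cf mB BB)].
  pose B' := box (a + t n *: e) (b + t n *: e).
  have mB' : measurable B' := measurable_box _ _.
  have if' := continuous_integrable_box cf mB' (@subset_refl _ _).
  have if_ := continuous_integrable_box cf mB BB.
  have -> : \int[L]_(x in B) f (x + t n *: e) = \int[L]_(x in B') f x.
    rewrite /Rintegral; congr fine.
    pose T' : {mfun borelRd d >-> borelRd d} := HB.pack (T (t n)) (isMeasurableFun.Build _ _ _ _ _ (mT (t n))).
    have -> : B = T' @^-1` B' by rewrite Tbox !addrK.
    transitivity (\int[pushforward L T']_(x in B') (f x)%:E)%E; last first.
      by apply: eq_measure_integral => A mA _; exact: lebesgue_Rd_translate.
    have TB : T' @^-1` B' = B by rewrite Tbox !addrK.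
    transitivity (\int[L]_(x in T' @^-1` B') (EFin \o f \o T') x)%E; first by rewrite TB.
    symmetry; apply: integral_pushforward => //.
    - by apply/measurable_EFinP; exact: continuous_measurable_Rd.
    - by rewrite TB; exact: (continuous_integrable_box (cfT (t n)) mB BB).
  have mBB' : measurable (B `&` B') by exact: measurableI.
  have mBmB' : measurable (B `\` B') by exact: measurableD.
  have mB'mB : measurable (B' `\` B) by exact: measurableD.
  have dis (X Y : set (borelRd d)) : [disjoint X `&` Y & X `\` Y].
    by rewrite disj_set2E; apply/eqP/seteqP; split => // x [[_ ?] []].
  have splitI (X Y : set (borelRd d)) : measurable (X `&` Y) -> measurable (X `\` Y) ->
      L.-integrable X (EFin \o f) ->
      \int[L]_(x in X) f x = \int[L]_(x in X `&` Y) f x + \int[L]_(x in X `\` Y) f x.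
    by move=> m1 m2 iX; rewrite -Rintegral_setU ?setUIDK ?dis//.
  have mB'B : measurable (B' `&` B) by exact: measurableI.
  rewrite (splitI B' B)// (splitI B B')//.
  rewrite (setIC B') opprD addrACA subrr add0r.
  pose up : 'rV[R]_d := \row_i (if i == k then b 0 k + t n else b 0 i).
  pose dn : 'rV[R]_d := \row_i (if i == k then b 0 k - t n else a 0 i).
  pose up' : 'rV[R]_d := \row_i (if i == k then a 0 k + t n *+ 2 else b 0 i).
  apply: (le_trans (ler_normB _ _)).
  (* The half-open slabs of thickness [t n] lie in open boxes of twice that
     thickness, hence the constant 4. *)
  rewrite (_ : t n * (4 * V) = 2 * t n * V + 2 * t n * V); last by ring.
  apply: lerD.
    rewrite -(thin dn up (t n))// => [|i /negPf ik|]; last 2 first.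
    - by rewrite !mxE ik.
    - by rewrite !mxE eqxx; ring.
    apply: normr_Rintegral_le_measure => // x [xB' xB] i; rewrite !mxE.
    have bx : b 0 k <= x 0 k.
      rewrite leNgt; apply/negP => xb; apply: xB => m.
      have := xB' m; rewrite !mxE eqxx/=; case: (eqVneq m k) => [->|mk]; rewrite /= ?mulr1 ?mulr0; last by lra.
      by have := t0 n; lra.
    have := xB' i; rewrite !mxE eqxx/=; case: eqVneq => [->|ik]; rewrite /= ?mulr1 ?mulr0; last by lra.
    by have := t0 n; lra.
  rewrite -(thin a up' (t n))// => [|i /negPf ik|]; last 2 first.
  - by rewrite !mxE ik.
  - by rewrite !mxE eqxx; ring.
  apply: normr_Rintegral_le_measure => // x [xB xB'] i; rewrite !mxE.
  have ax : x 0 k <= a 0 k + t n.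
    rewrite leNgt; apply/negP => xa; apply: xB' => m.
    have := xB m; rewrite !mxE eqxx/=; case: (eqVneq m k) => [->|mk]; rewrite /= ?mulr1 ?mulr0; last by lra.
    by have := t0 n; lra.
  have := xB i; case: eqVneq => [->|ik]; last by lra.
  by have := t0 n; lra.
have ccv : \int[L]_(x in B) (cst 1 x * D n x) @[n --> \oo] -->
    \int[L]_(x in B) (cst 1 x * partial f k x).
  have [M M0 HM] := continuous_cbox_bounded (a - const_mx 1) (b + const_mx 1) (C1f k).2.
  apply: (@cvg_Rintegral_bounded _ _ _ _ _ _ _ _ M) => //.
  - by apply: (@continuous_integrable_box (cst 1) a b) => //; exact: cst_continuous.
  - by move=> n; apply: measurable_funTS; exact: continuous_measurable_Rd.
  - by apply: measurable_funTS; apply: continuous_measurable_Rd; exact: (C1f k).2.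
  - move=> n x Bx; rewrite /D.
    have [c ct ->] := @partial_MVT R d f k x (t n) (C1f k).1.
    rewrite mulrC -mulrA divff ?gt_eqF// mulr1; apply: HM => i; rewrite !mxE eqxx/=.
    have /ler_normlP[c1 c2] : `|c| <= 1.
      by apply: (le_trans ct); rewrite gtr0_norm.
    by have := Bx i; case: eqVneq => [->|ik]; rewrite ?mulr1 ?mulr0; lra.
  - apply: aeW => x Bx.
    have dk : (fun h : R => h^-1 *: ((f \o shift x) (h *: e) - f x)) h @[h --> 0^'] -->
      partial f k x := (C1f k).1 x.
    have := (cvg_at_rightP (fun h : R => h^-1 *: ((f \o shift x) (h *: e) - f x)) 0 (partial f k x)).1
      (cvg_dnbhs_at_right dk) t (conj t0 cvg_harmonic).
    by under eq_fun do rewrite /= [_ + x]addrC.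
have -> : \int[L]_(x in box a b) partial f k x = \int[L]_(x in B) (cst 1 x * partial f k x).
  by apply: eq_Rintegral => x _; rewrite mul1r.
apply: cvgr_to_le (cvg_norm ccv) _; exact: nearW.
Qed.

End partial_box.

(** * Step functions on a partition into cubes *)

Lemma Rintegral_sum d (T : measurableType d) (R : realType)
    (mu : {measure set T -> \bar R}) (D : set T) (I : Type) (s : seq I)
    (f : I -> T -> R) : measurable D ->
  (forall i, mu.-integrable D (EFin \o f i)) ->
  \int[mu]_(x in D) (\sum_(i <- s) f i x) = \sum_(i <- s) \int[mu]_(x in D) f i x.
Proof.
move=> mD fi; elim: s => [|i s IH].
  under eq_Rintegral do rewrite big_nil; rewrite big_nil.
  by rewrite Rintegral_cst// mul0r.
under eq_Rintegral do rewrite big_cons; rewrite big_cons -IH -RintegralD//.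
exact: integrable_sum_real.
Qed.

Section cells.
Context {R : realType} {d : nat} {Omega : set 'rV[R]_d}.
Variables (oOmega : open Omega) (bOmega : bounded_set Omega).
Local Notation L := (@lebesgue_Rd R d).
Local Notation mu := (lebesgue_on oOmega).

Let mOmega : measurable (Omega : set (@borelRd R d)).
Proof. exact: open_measurable_Rd. Qed.

Lemma Omega_cbox : exists a b : 'rV[R]_d, Omega `<=` cbox a b.
Proof.
case: bOmega => M [_ HM]; exists (const_mx (- (`|M| + 1))), (const_mx (`|M| + 1)).
move=> x Ox k; rewrite !mxE -ler_norml.
have := HM (`|M| + 1) _ x Ox; rewrite (le_lt_trans (ler_norm _)) ?ltrDl// => /(_ isT).
apply: le_trans; rewrite [leRHS]mx_normrE.
exact: (le_bigmax _ (fun i : 'I_1 * 'I_d => `|x i.1 i.2|) (0, k)).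
Qed.

Lemma mu_sub (A : set (@borelRd R d)) : A `<=` Omega -> mu A = L A.
Proof. by move=> AO; rewrite /lebesgue_on /= /mrestr setIidl. Qed.

Lemma mu_setT_lty : (mu setT < +oo)%E.
Proof.
rewrite /lebesgue_on /= /mrestr setTI; have [a [b Oab]] := Omega_cbox.
apply: le_lt_trans (lebesgue_cbox_lty a b).
by apply: le_measure; rewrite ?inE//; exact: measurable_cbox.
Qed.

Lemma mu_setC0 : mu (~` (Omega : set (@borelRd R d))) = 0%E.
Proof. by rewrite /lebesgue_on /= /mrestr setICl measure0. Qed.

Lemma mu_bounded_integrable (f : @borelRd R d -> R) (M : R) :
  measurable_fun setT f -> (forall x, Omega x -> `|f x| <= M) ->
  mu.-integrable setT (EFin \o f).
Proof.
move=> mf fM.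
have mC : measurable (~` (Omega : set (@borelRd R d))) by exact: measurableC.
apply/(negligible_integrable mC) => //; first exact/measurable_EFinP.
  exact: mu_setC0.
rewrite setTD setCK; apply: measurable_bounded_integrable => //.
- apply: le_lt_trans mu_setT_lty; apply: le_measure; rewrite ?inE//.
- exact: measurable_funTS.
by exists M; split; rewrite ?num_real// => r Mr x Dx; apply: le_trans (ltW Mr); exact: fM.
Qed.

Lemma mu_continuous_integrable (f : 'rV[R]_d -> R) : continuous f ->
  mu.-integrable setT (EFin \o f).
Proof.
move=> cf; have [a [b Oab]] := Omega_cbox.
have [M M0 HM] := continuous_cbox_bounded a b cf.
apply: (@mu_bounded_integrable _ M); first exact: continuous_measurable_Rd.
by move=> x /Oab; exact: HM.
Qed.

Lemma mu_integrableM_continuous (w : @borelRd R d -> R) (f : 'rV[R]_d -> R) :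
  mu.-integrable setT (EFin \o w) -> continuous f ->
  mu.-integrable setT (EFin \o (fun x => w x * f x)).
Proof.
move=> iw cf; have [a [b Oab]] := Omega_cbox.
have [M M0 HM] := continuous_cbox_bounded a b cf.
have mf := continuous_measurable_Rd cf.
have mw : measurable_fun setT w by apply/measurable_EFinP; exact: measurable_int iw.
have mC : measurable (~` (Omega : set (@borelRd R d))) by exact: measurableC.
apply/(negligible_integrable mC) => //.
- by apply/measurable_EFinP; exact: measurable_funM.
- exact: mu_setC0.
rewrite setTD setCK; apply: (integrableM_bounded _ _ _ (M := M)) => //.
- exact: integrableS iw.
- exact: measurable_funTS.
- by move=> x /Oab; exact: HM.
Qed.

Lemma is_cubeE (Q : set 'rV[R]_d) (a : 'rV[R]_d) (l : R) : is_cube Q a l ->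
  [/\ 0 < l, measurable (Q : set (@borelRd R d)), box a (a + const_mx l) `<=` Q
    & Q `<=` cbox a (a + const_mx l)].
Proof.
case=> l0 mQ h1 h2; split => //.
  by move=> x xa; apply: h1 => k; have := xa k; rewrite !mxE.
by move=> x /h2 xa k; have := xa k; rewrite !mxE.
Qed.

Lemma cube_negligible (Q : set 'rV[R]_d) (a : 'rV[R]_d) (l : R) : is_cube Q a l ->
  L ((Q : set (@borelRd R d)) `\` box a (a + const_mx l)) = 0%E.
Proof.
move=> /is_cubeE[l0 mQ _ Qc]; have mb := measurable_box a (a + const_mx l).
apply/negligibleP; first exact: measurableD.
by apply: negligibleS (negligible_faces a (a + const_mx l)); exact: setSD.
Qed.

Lemma mu_cube (Q : set 'rV[R]_d) (a : 'rV[R]_d) (l : R) : is_cube Q a l ->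
  Q `<=` Omega -> mu Q = (l ^+ d)%:E.
Proof.
move=> cQ QO; have [l0 mQ bQ Qc] := is_cubeE cQ.
rewrite mu_sub//; transitivity (L (box a (a + const_mx l))).
  rewrite -[in LHS](setDUK bQ) measureU0//; first exact: measurable_box.
    by apply: measurableD => //; exact: measurable_box.
  exact: cube_negligible.
apply: (etrans (lebesgue_Rd_box _)) => [k|]; first by rewrite !mxE lerDl ltW.
congr EFin; rewrite (eq_bigr (fun=> l)) => [|k _]; last by rewrite !mxE; ring.
by rewrite prodr_const card_ord.
Qed.

Lemma integral_cube (Q : set 'rV[R]_d) (a : 'rV[R]_d) (l : R) (f : @borelRd R d -> R) :
  is_cube Q a l -> Q `<=` Omega -> mu.-integrable Q (EFin \o f) ->
  \int[mu]_(x in Q) f x = \int[L]_(x in box a (a + const_mx l)) f x.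
Proof.
move=> cQ QO fi; have [l0 mQ bQ Qc] := is_cubeE cQ.
have mb := measurable_box a (a + const_mx l).
rewrite /Rintegral; congr fine.
rewrite (@negligible_integral _ _ _ _ _ ((Q : set (@borelRd R d)) `\` box a (a + const_mx l)))//.
- rewrite setDD (setIidr bQ); apply: eq_measure_integral => A mA /= AB.
  by rewrite mu_sub//; exact: subset_trans (subset_trans AB bQ) QO.
- exact: measurableD.
- rewrite mu_sub; first exact: cube_negligible cQ.
  by move=> x []/QO.
Qed.

Section partition.
Context {N : nat} {Q : 'I_N -> set 'rV[R]_d} {h : R}.
Hypothesis hQ : cube_partition Omega Q h.

Lemma cell_sub i : Q i `<=` Omega.
Proof. by have [_ <- _] := hQ; exact: bigcup_sup. Qed.

Lemma cell_measurable i : measurable (Q i : set (@borelRd R d)).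
Proof. by have [_ _ [a [l [/(_ i)[]]]]] := hQ. Qed.

Lemma integral_cells (f : @borelRd R d -> R) : mu.-integrable setT (EFin \o f) ->
  \int[mu]_x f x = \sum_i \int[mu]_(x in Q i) f x.
Proof.
move=> fi; have [tQ QO _] := hQ.
have OE : Omega = \big[setU/set0]_(i <- index_enum 'I_N) Q i.
  rewrite -QO; apply/seteqP; split => x.
    by move=> [i _ Qx]; rewrite -bigcup_seq; exists i => //=; rewrite mem_index_enum.
  by rewrite -bigcup_seq => -[i _ Qx]; exists i.
have mC : measurable (~` (Omega : set (@borelRd R d))) by exact: measurableC.
rewrite /Rintegral (negligible_integral mC)//; last exact: mu_setC0.
rewrite setTD setCK [X in integral _ X]OE integral_bigsetU_EFin//.
- rewrite -sum_fine// => i _; apply: integrable_fin_num.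
    exact: cell_measurable.
  by apply: integrableS fi => //; exact: cell_measurable.
- exact: cell_measurable.
- exact: index_enum_uniq.
- by move=> i j _ _; exact: tQ.
- by apply/measurable_EFinP/measurable_funTS/measurable_EFinP; exact: measurable_int fi.
Qed.

Lemma step_fctE (c : 'rV[R]_N) i x : Q i x -> step_fct Q c x = c 0 i.
Proof.
move=> Qx; rewrite /step_fct (bigD1 i)//= indicE mem_set// mulr1 big1 ?addr0//.
move=> j ji; rewrite indicE memNset ?mulr0// => Qj.
have [tQ _ _] := hQ; have ij : i = j by apply: tQ => //; exists x.
by move: ji; rewrite ij eqxx.
Qed.

Lemma step_fct_measurable (c : 'rV[R]_N) :
  measurable_fun [set: @borelRd R d] (step_fct Q c).
Proof.
apply: measurable_sum => i; apply: measurable_funM => //.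
by apply: measurable_indic; exact: cell_measurable.
Qed.

Lemma step_fct_bound (c : 'rV[R]_N) x : `|step_fct Q c x| <= \sum_i `|c 0 i|.
Proof.
apply: (le_trans (ler_norm_sum _ _ _)); apply: ler_sum => i _.
rewrite normrM ler_piMr//; rewrite indicE; case: (_ \in _); rewrite ?normr1 ?normr0//.
Qed.

Lemma cell_avg_step (c : 'rV[R]_N) i : cell_avg oOmega Q (step_fct Q c) i = c 0 i.
Proof.
have [_ _ [a [l [cQ _]]]] := hQ.
rewrite /cell_avg (@eq_Rintegral _ _ _ _ _ (cst (c 0 i))); last first.
  by move=> x; rewrite inE => /step_fctE ->.
rewrite Rintegral_cst; last exact: cell_measurable.
rewrite (mu_cube (cQ i)); last exact: cell_sub.
have [l0 _ _ _] := cQ i.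
by rewrite /= mulrCA mulVf ?mulr1// expf_neq0// gt_eqF.
Qed.

Lemma step_fct_integrable (c : 'rV[R]_N) : mu.-integrable setT (EFin \o step_fct Q c).
Proof.
apply: (@mu_bounded_integrable _ (\sum_i `|c 0 i|)); first exact: step_fct_measurable.
by move=> x _; exact: step_fct_bound.
Qed.

(** The integral of a divergence over a cube is bounded by a multiple of the area
    of the faces, uniformly over the test fields. *)
Lemma BV_step_fct (c : 'rV[R]_N) : BV oOmega (step_fct Q c).
Proof.
have [_ _ [a [l [cQ _]]]] := hQ.
split.
  by apply/Lfun1_integrable; exact: step_fct_integrable.
have /choice[K KP] : forall p : 'I_N * 'I_d, exists K : R, forall f : 'rV[R]_d -> R,
    C1 f -> (forall x, `|f x| <= 1) ->
    `|\int[L]_(x in box (a p.1) (a p.1 + const_mx (l p.1))) partial f p.2 x| <= K.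
  by move=> [i k]; have [K _ HK] := partial_box_bound (a i) (a i + const_mx (l i)) k; exists K.
apply: (@le_lt_trans _ _ (\sum_i `|c 0 i| * \sum_k K (i, k))%:E); last exact: ltry.
apply: ub_ereal_sup => _ [phi [C1phi _ _ phi1] <-].
have phi1' k x : `|phi x 0 k| <= 1.
  rewrite -(@expr_le1 _ 2)// real_normK ?num_real//.
  apply: le_trans (phi1 x); rewrite (bigD1 k)//= lerDl.
  by apply: sumr_ge0 => i _; exact: sqr_ge0.
have cpart k : continuous (partial (fun x => phi x 0 k) k) := (C1phi k k).2.
have cdiv : continuous (divergence phi) by exact: continuous_sum_fct.
have wi : mu.-integrable setT (EFin \o (fun x => step_fct Q c x * divergence phi x)).
  have [a' [b' Oab]] := Omega_cbox.
  have [M M0 HM] := continuous_cbox_bounded a' b' cdiv.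
  apply: (@mu_bounded_integrable _ ((\sum_i `|c 0 i|) * M)).
    apply: measurable_funM; first exact: step_fct_measurable.
    exact: continuous_measurable_Rd.
  by move=> x /Oab/HM xM; rewrite normrM ler_pM// step_fct_bound.
apply: (@le_trans _ _ (\int[mu]_x (step_fct Q c x * divergence phi x))%:E).
  by rewrite /Rintegral fineK//; exact: integrable_fin_num.
rewrite lee_fin integral_cells//; apply: ler_sum => i _.
  rewrite (@eq_Rintegral _ _ _ _ _ (fun x : @borelRd R d => c 0 i * divergence phi x)); last first.
    by move=> x; rewrite inE => /step_fctE ->.
  have di : mu.-integrable (Q i) (EFin \o divergence phi).
    apply: integrableS (mu_continuous_integrable cdiv) => //; exact: cell_measurable.
  rewrite RintegralZl//; last exact: cell_measurable.
  apply: (le_trans (ler_norm _)); rewrite normrM ler_wpM2l//.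
  rewrite Rintegral_sum.
  - apply: (le_trans (ler_norm_sum _ _ _)); apply: ler_sum => k _.
    rewrite (integral_cube (cQ i)).
    + apply: (KP (i, k)); first exact: C1phi.
      exact: phi1'.
    + exact: cell_sub.
    + apply: integrableS (mu_continuous_integrable (cpart k)) => //; exact: cell_measurable.
  - exact: cell_measurable.
  - move=> k; apply: integrableS (mu_continuous_integrable (cpart k)) => //; exact: cell_measurable.
Qed.

End partition.
End cells.

(** * Smoothed indicators of intervals *)

Section spline.
Context {R : realType}.
Implicit Types (t s : R) (f g : R -> R).

Definition pospart t : R := (t + `|t|) / 2.

Lemma pospart_ge t : 0 <= t -> pospart t = t.
Proof. by move=> t0; rewrite /pospart ger0_norm//; lra. Qed.

Lemma pospart_le t : t <= 0 -> pospart t = 0.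
Proof. by move=> t0; rewrite /pospart ler0_norm//; lra. Qed.

Lemma continuous_pospart : continuous pospart.
Proof.
move=> t; apply: cvgMr_tmp; apply: cvgD; first exact: cvg_id.
exact: norm_continuous.
Qed.

(** A quadratic bound on the remainder can be checked by cases on signs, also at
    the kink of [pospart]. *)
Lemma is_derive_quadratic f t (df C : R) : 
  (forall h, `|f (t + h) - f t - h * df| <= C * h ^+ 2) -> is_derive t 1 f df.
Proof.
move=> H.
have C0 : 0 <= C by have := H 1; rewrite expr1n mulr1; exact: le_trans.
have E : (fun h : R => h^-1 *: ((f \o shift t) (h *: 1) - f t)) h @[h --> 0^'] --> df.
  apply/cvgrPdist_le => e e0; near=> h.
  have h0 : h != 0 by near: h; exact: nbhs_dnbhs_neq.
  have he : `|h| <= e / (C + 1) by near: h; apply: dnbhs0_le; rewrite divr_gt0// ltr_wpDl.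
  rewrite distrC /= [h *: 1]mulr1 [_ *: _]/(_ * _).
  have -> : h^-1 * (f (h + t) - f t) - df = h^-1 * (f (t + h) - f t - h * df).
    by rewrite [h + t]addrC; field.
  rewrite normrM normfV ler_pdivrMl ?normr_gt0//.
  apply: (le_trans (H h)); rewrite -[h ^+ 2]real_normK ?num_real// expr2 mulrCA ler_wpM2l//.
  move: he; rewrite ler_pdivlMr ?ltr_wpDl// mulrDr mulr1 mulrC; apply: le_trans.
  by rewrite lerDl.
split; first exact: cvgP E.
exact/cvg_lim.
Unshelve. all: by end_near. Qed.

Lemma is_derive_pospart2 t : is_derive t 1 (fun s => pospart s ^+ 2) (2 * pospart t).
Proof.
apply: (@is_derive_quadratic _ _ _ 1) => h; rewrite mul1r.
have [t0|t0] := leP 0 t; have [th|th] := leP 0 (t + h);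
  rewrite ?(pospart_ge t0) ?(pospart_le (ltW t0)) ?(pospart_ge th) ?(pospart_le (ltW th));
  rewrite ler_norml; apply/andP; split; nra.
Qed.

(** [(1, -2, 1)]-differences of the truncated powers [pospart t ^+ 3],
    [pospart t ^+ 2] and [pospart t]: the hat function and its successive
    primitives, normalised so that [sstep] rises from 0 to 1 on [[0, 2]]. *)
Definition ramp t : R :=
  (t * pospart t ^+ 2 - 2 * ((t - 1) * pospart (t - 1) ^+ 2) + (t - 2) * pospart (t - 2) ^+ 2) / 6.

Definition sstep t : R :=
  (pospart t ^+ 2 - 2 * pospart (t - 1) ^+ 2 + pospart (t - 2) ^+ 2) / 2.

Definition hat t : R := pospart t - 2 * pospart (t - 1) + pospart (t - 2).

Lemma is_derive_affine f (f' : R -> R) (a c t : R) :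
  (forall s, is_derive s 1 f (f' s)) -> is_derive t 1 (fun s => f (a * s + c)) (a * f' (a * t + c)).
Proof.
move=> df.
have da : is_derive t 1 (fun s : R => a * s + c) a.
  apply: (@is_derive_quadratic _ _ _ 0) => h.
  by rewrite (_ : _ - h * a = 0) ?normr0 ?mul0r//; ring.
rewrite mulrC.
exact: (@is_derive1_comp R f (fun s : R => a * s + c) t (f' (a * t + c)) a (df _) da).
Qed.

Lemma is_derive_lin2 f g (f' g' : R) (a b t : R) :
  is_derive t 1 f f' -> is_derive t 1 g g' ->
  is_derive t 1 (fun s => a * f s + b * g s) (a * f' + b * g').
Proof.
move=> df dg; exact: (is_deriveD (is_deriveZ a df) (is_deriveZ b dg)).
Qed.

Lemma is_derive_diff3 f (f' : R -> R) (c t : R) :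
  (forall s, is_derive s 1 f (f' s)) ->
  is_derive t 1 (fun s => (f s - 2 * f (s - 1) + f (s - 2)) / c)
    ((f' t - 2 * f' (t - 1) + f' (t - 2)) / c).
Proof.
move=> df.
have d1 := is_derive_affine 1 (-1) t df; have d2 := is_derive_affine 1 (-2) t df.
have := is_derive_lin2 c^-1 1 (is_derive_lin2 1 (-2) (df t) d1) (is_derive_lin2 c^-1 0 d2 d2).
rewrite (_ : (fun s => _) = (fun s => (f s - 2 * f (s - 1) + f (s - 2)) / c)); last first.
  by apply/funext => s; rewrite !mul1r; ring.
by rewrite (_ : c^-1 * _ + _ = (f' t - 2 * f' (t - 1) + f' (t - 2)) / c)// !mul1r; ring.
Qed.

Lemma is_derive_ramp t : is_derive t 1 ramp (sstep t).
Proof.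
have d3 s : is_derive s 1 (fun s => s * pospart s ^+ 2) (3 * pospart s ^+ 2).
  have := is_deriveM (is_derive_id s 1) (is_derive_pospart2 s).
  rewrite (_ : _ *: _ + _ = 3 * pospart s ^+ 2)//.
  rewrite /GRing.scale/= mulr1; have [s0|s0] := leP 0 s.
    by rewrite pospart_ge//; ring.
  by rewrite pospart_le ?ltW//; ring.
have := is_derive_diff3 6 t d3.
by rewrite (_ : _ / 6 = sstep t)// /sstep; field.
Qed.

Lemma is_derive_sstep t : is_derive t 1 sstep (hat t).
Proof.
have := is_derive_diff3 2 t is_derive_pospart2.
by rewrite (_ : _ / 2 = hat t)// /hat; field.
Qed.

Lemma pospartP t : (0 <= t /\ pospart t = t) \/ (t <= 0 /\ pospart t = 0).
Proof.
by have [t0|/ltW t0] := leP 0 t; [left|right]; split=> //; [exact: pospart_ge|exact: pospart_le].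
Qed.

Lemma hat_itv t : 0 <= hat t <= 1.
Proof.
rewrite /hat; case: (pospartP t) => -[h0 ->]; case: (pospartP (t - 1)) => -[h1 ->];
  case: (pospartP (t - 2)) => -[h2 ->]; lra.
Qed.

Lemma sstep_itv t : 0 <= sstep t <= 1.
Proof.
rewrite /sstep; case: (pospartP t) => -[h0 ->]; case: (pospartP (t - 1)) => -[h1 ->];
  case: (pospartP (t - 2)) => -[h2 ->]; apply/andP; split; nra.
Qed.

Lemma sstep_le0 t : t <= 0 -> sstep t = 0.
Proof. by move=> t0; rewrite /sstep !pospart_le; lra. Qed.

Lemma sstep_ge2 t : 2 <= t -> sstep t = 1.
Proof. by move=> t0; rewrite /sstep !pospart_ge; [field|lra..]. Qed.

Lemma ramp_le0 t : t <= 0 -> ramp t = 0.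
Proof. by move=> t0; rewrite /ramp !pospart_le; lra. Qed.

Lemma ramp_ge2 t : 2 <= t -> ramp t = t - 1.
Proof. by move=> t0; rewrite /ramp !pospart_ge; [field|lra..]. Qed.

Lemma is_derive_increment f (f' : R -> R) (m M s t : R) :
  (forall x : R, is_derive x (1 : R) f (f' x)) -> (forall x, m <= f' x <= M) -> s <= t ->
  m * (t - s) <= f t - f s <= M * (t - s).
Proof.
move=> df fM st.
have [|c _ ->] := @MVT_segment R f f' s t st (fun x _ => df x).
  apply: continuous_subspaceT => x.
  by apply/differentiable_continuous/derivable1_diffP; case: (df x).
by have /andP[m1 m2] := fM c; rewrite !ler_wpM2r// subr_ge0.
Qed.

Section bump.
Variables (a b e : R).
Hypotheses (e0 : 0 < e) (eab : 4 * e <= b - a).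

(** A spline approximation of the indicator of [[a, b]] with support in
    [[a + e, b - e]]; [bump_int] is its primitive. *)
Definition bump t : R := sstep ((t - a) / e - 1) - sstep ((t - b) / e + 3).

Definition bump_int t : R := e * (ramp ((t - a) / e - 1) - ramp ((t - b) / e + 3)).

Definition bump' t : R := (hat ((t - a) / e - 1) - hat ((t - b) / e + 3)) / e.

Lemma bump_args t : (t - b) / e + 3 <= (t - a) / e - 1.
Proof.
have -> : (t - b) / e + 3 = (t - b + 3 * e) / e by field; rewrite gt_eqF.
have -> : (t - a) / e - 1 = (t - a - e) / e by field; rewrite gt_eqF.
by rewrite ler_pM2r ?invr_gt0//; move: eab; lra.
Qed.

Let argE (c k s : R) : e^-1 * s + (- c / e + k) = (s - c) / e + k.
Proof. by ring. Qed.

Lemma is_derive_bump_int t : is_derive t 1 bump_int (bump t).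
Proof.
have d1 := is_derive_affine e^-1 (- a / e - 1) t is_derive_ramp.
have d2 := is_derive_affine e^-1 (- b / e + 3) t is_derive_ramp.
have := is_derive_lin2 e (- e) d1 d2.
rewrite (_ : (fun s => _) = bump_int); last first.
  by apply/funext => s; rewrite !argE /bump_int; ring.
rewrite !argE (_ : e * _ + _ = bump t)// /bump.
by field; rewrite gt_eqF.
Qed.

Lemma is_derive_bump t : is_derive t 1 bump (bump' t).
Proof.
have d1 := is_derive_affine e^-1 (- a / e - 1) t is_derive_sstep.
have d2 := is_derive_affine e^-1 (- b / e + 3) t is_derive_sstep.
have := is_derive_lin2 1 (-1) d1 d2.
rewrite (_ : (fun s => _) = bump); last first.
  by apply/funext => s; rewrite !argE /bump; ring.
by rewrite !argE (_ : 1 * _ + _ = bump' t)// /bump'; ring.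
Qed.

Lemma continuous_hat : continuous hat.
Proof.
have cp (c : R) : continuous (fun t => pospart (t - c)).
  move=> t; apply: (@continuous_comp _ _ _ (fun t => t - c) pospart).
    by apply: cvgB; [exact: cvg_id|exact: cvg_cst].
  exact: continuous_pospart.
move=> t; apply: cvgD; last exact: cp.
apply: cvgB; first exact: continuous_pospart.
by apply: cvgMl_tmp; exact: cp.
Qed.

Lemma continuous_bump' : continuous bump'.
Proof.
have ch (c k : R) : continuous (fun t => hat ((t - c) / e + k)).
  move=> t; apply: (@continuous_comp _ _ _ (fun t => (t - c) / e + k) hat).
    apply: cvgD; last exact: cvg_cst.
    by apply: cvgMr_tmp; apply: cvgB; [exact: cvg_id|exact: cvg_cst].
  exact: continuous_hat.
by move=> t; apply: cvgMr_tmp; apply: cvgB; exact: ch.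
Qed.

Lemma bump_itv t : 0 <= bump t <= 1.
Proof.
have /andP[+ _] := is_derive_increment is_derive_sstep hat_itv (bump_args t).
have := sstep_itv ((t - a) / e - 1); have := sstep_itv ((t - b) / e + 3).
by rewrite /bump; lra.
Qed.

Lemma bump_int_itv t : 0 <= bump_int t <= b - a - 4 * e.
Proof.
have /andP[] := is_derive_increment is_derive_ramp sstep_itv (bump_args t).
rewrite mul0r mul1r /bump_int => h1 h2; have e1 := ltW e0.
apply/andP; split; first exact: mulr_ge0.
apply: (@le_trans _ _ (e * ((t - a) / e - 1 - ((t - b) / e + 3)))).
  exact: ler_wpM2l.
by rewrite (_ : _ * _ = b - a - 4 * e)//; field; rewrite gt_eqF.
Qed.

Lemma bump_args_le0 t : t <= a + e -> (t - a) / e - 1 <= 0.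
Proof. by move=> ta; rewrite subr_le0 ler_pdivrMr// mul1r; lra. Qed.

Lemma bump_args_ge2 t : b - e <= t -> 2 <= (t - b) / e + 3.
Proof. by move=> tb; rewrite -lerBlDr ler_pdivlMr//; lra. Qed.

Lemma bump_lo t : t <= a + e -> bump t = 0.
Proof.
move=> /bump_args_le0 h; rewrite /bump !sstep_le0 ?subrr//.
exact: le_trans (bump_args t) h.
Qed.

Lemma bump_hi t : b - e <= t -> bump t = 0.
Proof.
move=> /bump_args_ge2 h; rewrite /bump !sstep_ge2 ?subrr//.
exact: le_trans h (bump_args t).
Qed.

Lemma bump_int_lo t : t <= a + e -> bump_int t = 0.
Proof.
move=> /bump_args_le0 h; rewrite /bump_int !ramp_le0 ?subrr ?mulr0//.
exact: le_trans (bump_args t) h.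
Qed.

Lemma bump_int_hi t : b - e <= t -> bump_int t = b - a - 4 * e.
Proof.
move=> /bump_args_ge2 h; rewrite /bump_int !ramp_ge2//; last exact: le_trans h (bump_args t).
by field; rewrite gt_eqF.
Qed.

Lemma bump_mid t : a + 3 * e <= t -> t <= b - 3 * e -> bump t = 1.
Proof.
move=> ta tb; rewrite /bump sstep_ge2 ?sstep_le0 ?subr0//.
  by rewrite -lerBrDr sub0r ler_pdivrMr//; lra.
by rewrite lerBrDr ler_pdivlMr//; lra.
Qed.

End bump.
End spline.

(** * Differentiation of products of functions of one variable *)

Section smooth.
Context {R : realType} {d : nat}.
Local Notation ee := (delta_mx 0 : 'I_d -> 'rV[R]_d).
Implicit Types (x : 'rV[R]_d) (f g : 'rV[R]_d -> R).

(** Carries the partial derivatives along, so that those of sums and products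
    are known without taking limits again. *)
Definition gradient f (Df : 'I_d -> 'rV[R]_d -> R) :=
  forall i, (forall x, is_derive x (ee i) f (Df i x)) /\ continuous (Df i).

Lemma gradient_partial f Df : gradient f Df -> forall i, partial f i = Df i.
Proof. by move=> H i; apply/funext => x; have [/(_ x)[]] := H i. Qed.

Lemma gradient_C1 f Df : gradient f Df -> C1 f.
Proof.
move=> H i; rewrite (gradient_partial H); have [dH cH] := H i.
by split => // x; case: (dH x).
Qed.

Lemma gradientZ f Df (c : R) : gradient f Df ->
  gradient (fun x => c * f x) (fun i x => c * Df i x).
Proof.
move=> H i; have [dH cH] := H i; split.
  by move=> x; exact: (is_deriveZ c (dH x)).
move=> x; apply: (@continuousM _ _ (cst c) (Df i) x); first exact: cst_continuous.
exact: cH.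
Qed.

Lemma gradient_sum (I : Type) (s : seq I) (F : I -> 'rV[R]_d -> R)
    (DF : I -> 'I_d -> 'rV[R]_d -> R) : (forall m, gradient (F m) (DF m)) ->
  gradient (fun x => \sum_(m <- s) F m x) (fun i x => \sum_(m <- s) DF m i x).
Proof.
move=> H i; split; last by apply: continuous_sum_fct => m; exact: (H m i).2.
move=> x; elim: s => [|m s IH].
  under eq_fun do rewrite big_nil; rewrite big_nil; exact: is_derive_cst.
under eq_fun do rewrite big_cons; rewrite big_cons.
exact: (is_deriveD ((H m i).1 x) IH).
Qed.

Lemma continuous_prod_fct (I : Type) (s : seq I) (F : I -> 'rV[R]_d -> R) :
  (forall i, continuous (F i)) -> continuous (fun x => \prod_(i <- s) F i x).
Proof.
move=> cF; elim: s => [|i s IH].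
  by under eq_fun do rewrite big_nil; exact: cst_continuous.
under eq_fun do rewrite big_cons.
move=> x; apply: (@continuousM _ _ (F i) (fun x => \prod_(i <- s) F i x) x).
  exact: cF.
exact: IH.
Qed.

(** Along the [i]-th axis only the [i]-th factor varies. *)
Lemma gradient_prod (F F' : 'I_d -> R -> R) :
  (forall j (t : R), is_derive t (1 : R) (F j) (F' j t)) -> (forall j, continuous (F' j)) ->
  gradient (fun x => \prod_j F j (x 0 j))
    (fun i x => \prod_j (if j == i then F' j else F j) (x 0 j)).
Proof.
move=> dF cF' i.
have cF j : continuous (F j).
  by move=> t; apply/differentiable_continuous/derivable1_diffP; case: (dF j t).
split; last first.
  apply: continuous_prod_fct => j x.
  apply: (@continuous_comp _ _ _ (fun x : 'rV[R]_d => x 0 j)); first exact: coord_continuous_rV.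
  by case: ifP => _; [exact: cF'|exact: cF].
move=> x; pose P := \prod_(j < d | j != i) F j (x 0 j).
have E : (fun h : R => h^-1 *: (((fun x => \prod_j F j (x 0 j)) \o shift x) (h *: ee i)
     - \prod_j F j (x 0 j))) =
   (fun h : R => (h^-1 *: ((F i \o shift (x 0 i)) (h *: 1) - F i (x 0 i))) * P).
  apply/funext => h /=; rewrite (bigD1 i)//= [in X in _ - X](bigD1 i)//= -/P.
  rewrite (eq_bigr (fun j => F j (x 0 j))) => [|j /negPf ji]; last first.
    by rewrite !mxE ji andbF mulr0 add0r.
  by rewrite -/P -mulrBl scalerAl !mxE !eqxx mulr1 [h *: 1]mulr1.
have dv : \prod_j (if j == i then F' j else F j) (x 0 j) = F' i (x 0 i) * P.
  by rewrite (bigD1 i)//= eqxx; congr (_ * _); apply: eq_bigr => j /negPf ->.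
have lim1 : (fun h : R => h^-1 *: ((F i \o shift (x 0 i)) (h *: 1) - F i (x 0 i))) h @[h --> 0^'] -->
    F' i (x 0 i).
  by have [ex <-] := dF i (x 0 i); exact: ex.
have lim2 : (fun h : R => (h^-1 *: ((F i \o shift (x 0 i)) (h *: 1) - F i (x 0 i))) * P) h @[h --> 0^'] -->
    F' i (x 0 i) * P.
  by apply: cvgMr_tmp; exact: lim1.
rewrite dv; split; first by rewrite /derivable E; exact: cvgP lim2.
by rewrite /derive E; exact/cvg_lim.
Qed.

End smooth.

(** * Test fields on a cube *)

Section cube_field.
Context {R : realType} {d : nat}.
Variables (a : 'rV[R]_d) (l : R) (M : nat) (e : R) (c : {ffun 'I_d -> 'I_M} -> R).
Hypotheses (l0 : 0 < l) (M0 : (0 < M)%N) (e0 : 0 < e) (eM : 4 * e < l / M%:R).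
Hypothesis c1 : forall m, `|c m| <= 1.

Definition node (j : 'I_d) (p : nat) : R := a 0 j + p%:R * (l / M%:R).

Let I0 : R := l / M%:R - 4 * e.
Let G (j : 'I_d) (p : 'I_M) (t : R) := bump (node j p) (node j p.+1) e t.
Let GI (j : 'I_d) (p : 'I_M) (t : R) := bump_int (node j p) (node j p.+1) e t.
Let E (j : 'I_d) (t : R) := bump (a 0 j) (a 0 j + l) e t / (l - 4 * e).
Let EI (j : 'I_d) (t : R) := bump_int (a 0 j) (a 0 j + l) e t / (l - 4 * e).

Definition field_factor (k : nat) (p : 'I_M) (j : 'I_d) (t : R) : R :=
  if (j < k)%N then I0 * E j t else if j == k :> nat then GI j p t - I0 * EI j t else G j p t.

(** The partial derivative of the product of the [field_factor k] along the [k]-th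
    axis is the difference of the products of [div_factor k] and [div_factor k.+1]. *)
Definition div_factor (k : nat) (p : 'I_M) (j : 'I_d) (t : R) : R :=
  if (j < k)%N then I0 * E j t else G j p t.

(** [cube_field] is a compactly supported solution of div phi = g - (weighted
    mean of g), where g is the smoothed step function with value [c m] on the grid
    box with index [m]: component [k] transports mass along the [k]-th axis, after
    the first [k] variables have been averaged with the weight [E], so that the
    sum of the partial derivatives telescopes. *)
Definition cube_field (x : 'rV[R]_d) : 'rV[R]_d :=
  \row_k \sum_m c m * \prod_j field_factor k (m j) j (x 0 j).

Let M0' : 0 < M%:R :> R. Proof. by rewrite ltr0n. Qed.

Let M1' : 1 <= M%:R :> R. Proof. by rewrite ler1n. Qed.

Let lMl : l / M%:R <= l.
Proof. by rewrite ler_pdivrMr// ler_peMr// ltW. Qed.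

Let el : 0 < l - 4 * e.
Proof. by rewrite subr_gt0; exact: lt_le_trans eM lMl. Qed.

Let I0_ge0 : 0 <= I0.
Proof. by rewrite subr_ge0 ltW. Qed.

Let nodeB j p : node j p.+1 - node j p = l / M%:R.
Proof. by rewrite /node -natr1; ring. Qed.

Let node_lo j p : a 0 j <= node j p.
Proof. by rewrite /node lerDl mulr_ge0// divr_ge0// ltW. Qed.

Let node_hi j (p : 'I_M) : node j p.+1 <= a 0 j + l.
Proof.
rewrite /node lerD2l mulrCA; apply: ler_piMr; first exact: ltW.
by rewrite ler_pdivrMr// mul1r ler_nat; exact: ltn_ord.
Qed.

Let hG j p : 4 * e <= node j p.+1 - node j p.
Proof. by rewrite nodeB ltW. Qed.

Let hE j : 4 * e <= a 0 j + l - a 0 j.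
Proof. by rewrite addrC addKr ltW// -subr_gt0. Qed.

Let G_itv j p t : 0 <= G j p t <= 1.
Proof. exact: bump_itv e0 (hG j p) t. Qed.

Let GI_itv j p t : 0 <= GI j p t <= I0.
Proof. by have := bump_int_itv e0 (hG j p) t; rewrite nodeB. Qed.

Let E_ge0 j t : 0 <= E j t.
Proof.
by apply: divr_ge0; [have /andP[] := bump_itv e0 (hE j) t|exact: ltW].
Qed.

Let ME_le1 j t : M%:R * (I0 * E j t) <= 1.
Proof.
have /andP[b0 b1] := bump_itv e0 (hE j) t.
rewrite mulrA (_ : M%:R * I0 = l - 4 * e * M%:R); last by rewrite /I0; field; rewrite gt_eqF.
rewrite /E mulrA ler_pdivrMr// mul1r.
apply: (@le_trans _ _ ((l - 4 * e) * 1)); last by rewrite mulr1.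
have h : l - 4 * e * M%:R <= l - 4 * e.
  by rewrite lerD2l lerN2 ler_peMr// mulr_ge0// ltW.
apply: (@le_trans _ _ ((l - 4 * e) * bump (a 0 j) (a 0 j + l) e t)).
  exact: ler_wpM2r.
by apply: ler_wpM2l => //; exact: ltW.
Qed.

Let I0E_ge0 j t : 0 <= I0 * E j t.
Proof. by rewrite mulr_ge0. Qed.

Let I0E_le1 j t : I0 * E j t <= 1.
Proof.
apply: le_trans (ME_le1 j t); exact: ler_peMl.
Qed.

Let EI_itv j t : 0 <= I0 * EI j t <= I0.
Proof.
have := bump_int_itv e0 (hE j) t; rewrite [a 0 j + l]addrC addrK => /andP[b0 b1].
rewrite /EI addrC; apply/andP; split; first by rewrite mulr_ge0// divr_ge0// ltW.
by rewrite ler_piMr// ler_pdivrMr// mul1r.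
Qed.

Let G_eq0 j (p : 'I_M) t : t <= a 0 j + e \/ a 0 j + l - e <= t -> G j p t = 0.
Proof.
move=> [h|h]; [apply: (bump_lo e0 (hG j p))|apply: (bump_hi e0 (hG j p))].
  by apply: (le_trans h); rewrite lerD2r.
by apply: le_trans h; rewrite lerD2r.
Qed.

Let E_eq0 j t : t <= a 0 j + e \/ a 0 j + l - e <= t -> E j t = 0.
Proof.
by rewrite /E => -[h|h]; [rewrite (bump_lo e0 (hE j))|rewrite (bump_hi e0 (hE j))]; rewrite ?mul0r.
Qed.

Let GIE_eq0 j (p : 'I_M) t : t <= a 0 j + e \/ a 0 j + l - e <= t ->
  GI j p t - I0 * EI j t = 0.
Proof.
rewrite /EI /GI => -[h|h].
  rewrite (bump_int_lo e0 (hE j))// (bump_int_lo e0 (hG j p)) ?mul0r ?mulr0 ?subrr//.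
  by apply: (le_trans h); rewrite lerD2r.
rewrite (bump_int_hi e0 (hE j))// (bump_int_hi e0 (hG j p)); last first.
  by apply: le_trans h; rewrite lerD2r.
rewrite nodeB (_ : a 0 j + l - a 0 j = l); last by ring.
by rewrite divff ?gt_eqF// mulr1 subrr.
Qed.

Let sumG_le1 j t : \sum_p G j p t <= 1.
Proof.
have [[p Gp]|H] := pselect (exists p, G j p t != 0); last first.
  rewrite big1 ?ler01// => p _; apply/eqP/negPn/negP => Gp; apply: H; by exists p.
have [pt1 pt2] : node j p < t /\ t < node j p.+1.
  split; rewrite ltNge; apply: contra Gp => h; apply/eqP.
    by apply: (bump_lo e0 (hG j p)); apply: (le_trans h); rewrite lerDl ltW.
  by apply: (bump_hi e0 (hG j p)); apply: le_trans h; rewrite gerDl oppr_le0 ltW.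
have mono (q r : nat) : (q <= r)%N -> node j q <= node j r.
  by move=> qr; rewrite /node lerD2l ler_wpM2r ?ler_nat// divr_ge0// ltW.
rewrite (bigD1 p)//= big1 ?addr0 => [|q qp]; first by have /andP[] := G_itv j p t.
have [pq|] := ltnP p q.
  apply: (bump_lo e0 (hG j q)); apply: (@le_trans _ _ (node j q)).
    by apply: le_trans (ltW pt2) _; exact: mono.
  by rewrite lerDl ltW.
rewrite leq_eqVlt val_eqE (negPf qp)/= => qp'.
apply: (bump_hi e0 (hG j q)); apply: (@le_trans _ _ (node j q.+1)).
  by rewrite gerDl oppr_le0 ltW.
by apply: le_trans (ltW pt1); exact: mono.
Qed.

Let sumF_le k j t : \sum_p `|field_factor k p j t| <= (if j == k :> nat then l else 1).
Proof.
rewrite /field_factor; case: ltngtP => jk.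
- rewrite sumr_const card_ord -mulr_natl ger0_norm//; exact: ME_le1.
- apply: le_trans (sumG_le1 j t); apply: ler_sum => p _.
  by rewrite ger0_norm//; have /andP[] := G_itv j p t.
apply: (@le_trans _ _ (\sum_(p < M) I0)).
  apply: ler_sum => p _; rewrite ler_norml.
  by have := GI_itv j p t; have := EI_itv j t; lra.
rewrite sumr_const card_ord -mulr_natl (_ : M%:R * I0 = l - 4 * e * M%:R); last first.
  by rewrite /I0; field; rewrite gt_eqF.
by rewrite gerDl oppr_le0 !mulr_ge0// ltW.
Qed.

(** Distributing the sum over grid boxes along the axes turns the bound of the
    field into one-dimensional bounds, of which only the [k]-th one is not 1. *)
Lemma cube_field_bound x k : `|cube_field x 0 k| <= l.
Proof.
rewrite mxE; apply: (le_trans (ler_norm_sum _ _ _)).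
apply: (@le_trans _ _ (\sum_(m : {ffun 'I_d -> 'I_M}) \prod_j `|field_factor k (m j) j (x 0 j)|)).
  apply: ler_sum => m _; rewrite normrM normr_prod ler_piMl// prodr_ge0//.
rewrite -(bigA_distr_bigA (fun j p => `|field_factor k p j (x 0 j)|)).
apply: (@le_trans _ _ (\prod_(j < d) (if j == k :> nat then l else 1))).
  by apply: ler_prod => j _; rewrite sumF_le andbT; apply: sumr_ge0.
rewrite (bigD1 k)//= eqxx big1 ?mulr1// => j jk.
by rewrite val_eqE (negPf jk).
Qed.

Lemma cube_field_supp x : cube_field x != 0 ->
  cbox (a + const_mx e) (a + const_mx (l - e)) x.
Proof.
apply: contraNP => /existsNP[j /negP xj]; apply/eqP/rowP => k; rewrite !mxE.
rewrite big1// => m _; rewrite (bigD1 j)//= [X in _ * (X * _)](_ : _ = 0) ?mul0r ?mulr0//.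
have {}xj : x 0 j <= a 0 j + e \/ a 0 j + l - e <= x 0 j.
  by move: xj; rewrite !mxE negb_and -!ltNge => /orP[] h; [left|right]; lra.
rewrite /field_factor (E_eq0 xj) mulr0 (GIE_eq0 (m j) xj) (G_eq0 (m j) xj).
by rewrite !if_same.
Qed.

Let dF k p j t : is_derive t (1 : R) (field_factor k p j)
  (if (j < k)%N then I0 * (bump' (a 0 j) (a 0 j + l) e t / (l - 4 * e))
   else if j == k :> nat then G j p t - I0 * E j t
   else bump' (node j p) (node j p.+1) e t).
Proof.
rewrite /field_factor; case: ltngtP => jk.
- have := is_derive_lin2 (I0 / (l - 4 * e)) 0 (is_derive_bump (a 0 j) (a 0 j + l) e t) (is_derive_bump (a 0 j) (a 0 j + l) e t).
  rewrite mul0r addr0 (_ : (fun s => _) = (fun s => I0 * E j s)).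
    by rewrite mulrAC -mulrA.
  by apply/funext => s; rewrite /E; ring.
- exact: is_derive_bump.
have := is_derive_lin2 1 (- I0 / (l - 4 * e)) (is_derive_bump_int (node j p) (node j p.+1) e0 t) (is_derive_bump_int (a 0 j) (a 0 j + l) e0 t).
rewrite (_ : (fun s => _) = (fun s => GI j p s - I0 * EI j s)); last first.
  by apply/funext => s; rewrite /GI /EI; ring.
by rewrite (_ : 1 * _ + _ = G j p t - I0 * E j t)// /G /E; ring.
Qed.

Let cdF (k : nat) (p : 'I_M) (j : 'I_d) : continuous (fun t : R =>
  if (j < k)%N then I0 * (bump' (a 0 j) (a 0 j + l) e t / (l - 4 * e))
  else if j == k :> nat then G j p t - I0 * E j t
  else bump' (node j p) (node j p.+1) e t).
Proof.
have cb (u v : R) : continuous (bump u v e).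
  by move=> t; apply/differentiable_continuous/derivable1_diffP; case: (is_derive_bump u v e t).
case: ltngtP => jk; [|exact: continuous_bump'|] => t.
  by apply: cvgMl_tmp; apply: cvgMr_tmp; exact: continuous_bump'.
apply: cvgB; first exact: cb.
by apply: cvgMl_tmp; apply: cvgMr_tmp; exact: cb.
Qed.

Let gradF (k : 'I_d) : exists2 D, gradient (fun x => cube_field x 0 k) D &
  forall x, D k x = \sum_m c m * (\prod_j div_factor k (m j) j (x 0 j) -
                                 \prod_j div_factor k.+1 (m j) j (x 0 j)).
Proof.
have g1 (m : {ffun 'I_d -> 'I_M}) :=
  gradientZ (c m) (gradient_prod (fun j => dF k (m j) j) (fun j => @cdF k (m j) j)).
have g2 := gradient_sum (index_enum _) g1.
rewrite (_ : (fun x => \sum_(m <- _) _) = (fun x => cube_field x 0 k)) in g2; last first.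
  by apply/funext => x; rewrite mxE.
eexists; first exact: g2.
move=> x /=; apply: eq_bigr => m _; congr (_ * _).
rewrite (bigD1 k)//= eqxx ltnn eqxx.
rewrite [in RHS](bigD1 k)//= [in X in _ = _ - X](bigD1 k)//= /div_factor ltnn ltnSn mulrBl.
have jkE j : j != k -> (j == k :> nat) = false by move=> jk; rewrite val_eqE (negPf jk).
congr (_ * _ - _ * _); apply: eq_bigr => j jk; rewrite (negPf jk) /field_factor (jkE _ jk)//.
by rewrite ltnS [(j <= k)%N]leq_eqVlt (jkE _ jk).
Qed.

Lemma cube_field_C1 k : C1 (fun x => cube_field x 0 k).
Proof. by have [D /gradient_C1] := gradF k. Qed.

Lemma cube_field_divergence x : divergence cube_field x =
  \sum_m c m * (\prod_j div_factor 0 (m j) j (x 0 j) - \prod_j div_factor d (m j) j (x 0 j)).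
Proof.
rewrite /divergence.
transitivity (\sum_(k < d) \sum_m c m * (\prod_j div_factor k (m j) j (x 0 j) -
                                 \prod_j div_factor k.+1 (m j) j (x 0 j))).
  by apply: eq_bigr => k _; have [D gD <-] := gradF k; rewrite (gradient_partial gD).
rewrite exchange_big; apply: eq_bigr => m _; rewrite -mulr_sumr; congr (_ * _).
apply/eqP; rewrite -eqr_opp -sumrN opprB; apply/eqP.
rewrite -(telescope_sumr (fun k => \prod_j div_factor k (m j) j (x 0 j)) (leq0n d)) big_mkord.
by apply: eq_bigr => k _; rewrite opprB.
Qed.

Let div_factor_itv k p j t : 0 <= div_factor k p j t <= 1.
Proof. by rewrite /div_factor; case: ifP => _; rewrite ?I0E_ge0 ?I0E_le1 ?G_itv. Qed.

Lemma cube_field_divergence_bound x :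
  `|divergence cube_field x| <= #|{ffun 'I_d -> 'I_M}|%:R.
Proof.
rewrite cube_field_divergence; apply: (le_trans (ler_norm_sum _ _ _)).
apply: (@le_trans _ _ (\sum_(m : {ffun 'I_d -> 'I_M}) 1)); last by rewrite sumr_const.
apply: ler_sum => m _; rewrite normrM -[leRHS]mulr1 ler_pM//.
have p01 k : 0 <= \prod_j div_factor k (m j) j (x 0 j) <= 1.
  apply/andP; split; first by apply: prodr_ge0 => j _; have /andP[] := div_factor_itv k (m j) j (x 0 j).
  apply: (@le_trans _ _ (\prod_(j < d) 1)); last by rewrite big1.
  by apply: ler_prod => j _; exact: div_factor_itv.
have := p01 0%N; have := p01 d; rewrite ler_norml; lra.
Qed.

Lemma cube_field_divergence_out x : ~ box a (a + const_mx l) x ->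
  divergence cube_field x = 0.
Proof.
move=> /existsNP[j /negP xj]; rewrite cube_field_divergence big1// => m _.
have {}xj : x 0 j <= a 0 j + e \/ a 0 j + l - e <= x 0 j.
  by move: xj (e0); rewrite !mxE negb_and -!leNgt => /orP[] h e_0; [left|right]; lra.
rewrite (bigD1 j)//= [in X in _ - X](bigD1 j)//= /div_factor (G_eq0 (m j) xj) (E_eq0 xj).
by rewrite mulr0 !if_same !mul0r subrr mulr0.
Qed.

Lemma cube_field_divergence_in (x : 'rV[R]_d) (m0 : {ffun 'I_d -> 'I_M}) :
  (forall j, node j (m0 j) + 3 * e <= x 0 j <= node j (m0 j).+1 - 3 * e) ->
  divergence cube_field x = c m0 - ((l / M%:R - 4 * e) / (l - 4 * e)) ^+ d * \sum_m c m.
Proof.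
move=> xm; rewrite cube_field_divergence.
have E1 j : I0 * E j (x 0 j) = (l / M%:R - 4 * e) / (l - 4 * e).
  have /andP[h1 h2] := xm j; rewrite /E (bump_mid e0) ?mul1r//.
    by apply: le_trans h1; rewrite lerD2r.
  by apply: (le_trans h2); rewrite lerD2r.
have Ed (m : {ffun 'I_d -> 'I_M}) : \prod_j div_factor d (m j) j (x 0 j) = ((l / M%:R - 4 * e) / (l - 4 * e)) ^+ d.
  rewrite (eq_bigr (fun=> (l / M%:R - 4 * e) / (l - 4 * e))).
    by rewrite prodr_const card_ord.
  by move=> j _; rewrite /div_factor ltn_ord E1.
have mono j (q r : nat) : (q <= r)%N -> node j q <= node j r.
  by move=> qr; rewrite /node lerD2l ler_wpM2r ?ler_nat// divr_ge0// ltW.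
have G1 j p : G j p (x 0 j) = (p == m0 j)%:R.
  have /andP[h1 h2] := xm j; case: (ltngtP p (m0 j)) => pm.
  - have -> : (p == m0 j) = false by apply/negP => /eqP pe; move: pm; rewrite pe ltnn.
    apply: (bump_hi e0 (hG j p)); have := mono j _ _ pm; move: h1 (e0); lra.
  - have -> : (p == m0 j) = false by apply/negP => /eqP pe; move: pm; rewrite pe ltnn.
    apply: (bump_lo e0 (hG j p)); have := mono j _ _ pm; move: h2 (e0); lra.
  by rewrite (val_inj pm) eqxx; apply: (bump_mid e0).
have G0 (m : {ffun 'I_d -> 'I_M}) : \prod_j div_factor 0 (m j) j (x 0 j) = (m == m0)%:R.
  have [->|mm0] := eqVneq m m0; first by rewrite big1// => j _; rewrite /div_factor /= G1 eqxx.
  have [j mj] : exists j, m j != m0 j.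
    by apply/existsP; rewrite -negb_forall; apply: contra mm0 => /forallP h; apply/eqP/ffunP => j; exact/eqP.
  by rewrite (bigD1 j)//= /div_factor ltn0 G1 (negPf mj) mul0r.
under eq_bigr do rewrite Ed G0 mulrBr.
rewrite sumrB (bigD1 m0)//= eqxx mulr1 big1 ?addr0 => [|m /negPf ->]; last by rewrite mulr0.
by rewrite -mulr_suml mulrC.
Qed.

End cube_field.

(** * Approximation of measurable sets by dyadic grids *)

Section dyadic_grid.
Context {R : realType} {d : nat}.
Variables (a : 'rV[R]_d) (l : R).
Hypothesis l0 : 0 < l.
Implicit Types (x y : 'rV[R]_d) (A B : set (@borelRd R d)).

Definition grid_label (n : nat) (x : 'rV[R]_d) : {ffun 'I_d -> int} :=
  [ffun j => Num.floor (2 ^+ n * ((x 0 j - a 0 j) / l))].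

(** Being a union of grid cells, as an invariance that is visibly preserved by
    complements and unions. *)
Definition grid_set n A := forall x y, grid_label n x = grid_label n y -> A x -> A y.

Lemma grid_labelP n x y : grid_label n x = grid_label n y <->
  forall j (k : int), (k%:~R <= 2 ^+ n * ((x 0 j - a 0 j) / l)) =
                      (k%:~R <= 2 ^+ n * ((y 0 j - a 0 j) / l)).
Proof.
split=> [/ffunP H j k|H].
  by have := H j; rewrite !ffunE => E; rewrite -!floor_ge_int E.
apply/ffunP => j; rewrite !ffunE; apply/eqP; rewrite eq_le !floor_ge_int.
by apply/andP; split; [rewrite -H|rewrite H]; exact: floor_le.
Qed.

Lemma grid_labelS n x y : grid_label n.+1 x = grid_label n.+1 y ->
  grid_label n x = grid_label n y.
Proof.
move=> /grid_labelP H; apply/grid_labelP => j k.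
have := H j (2 * k); rewrite intrM exprS -!mulrA !ler_pM2l//.
Qed.

Lemma grid_label_le n m x y : (n <= m)%N -> grid_label m x = grid_label m y ->
  grid_label n x = grid_label n y.
Proof.
elim: m => [|m IH]; first by rewrite leqn0 => /eqP ->.
by rewrite leq_eqVlt => /predU1P[->//|]; rewrite ltnS => /IH {}IH /grid_labelS.
Qed.

Lemma grid_set_le n m A : (n <= m)%N -> grid_set n A -> grid_set m A.
Proof. by move=> nm gA x y /(grid_label_le nm); exact: gA. Qed.

Lemma grid_setC n A : grid_set n A -> grid_set n (~` A).
Proof. by move=> gA x y xy nAx Ay; apply: nAx; exact: gA Ay. Qed.

Lemma grid_setU n A B : grid_set n A -> grid_set n B -> grid_set n (A `|` B).
Proof. by move=> gA gB x y xy [/(gA _ _ xy)|/(gB _ _ xy)]; [left|right]. Qed.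

Lemma measurable_grid_cell n (v : {ffun 'I_d -> int}) :
  measurable ([set x : 'rV[R]_d | grid_label n x = v] : set (borelRd d)).
Proof.
have := @measurable_coords_set R d (fun j => `[a 0 j + (v j)%:~R / 2 ^+ n * l,
   a 0 j + (v j + 1)%:~R / 2 ^+ n * l[%classic).
rewrite (_ : [set x : 'rV[R]_d | _] = [set x : 'rV[R]_d | grid_label n x = v]).
  by apply => j; exact: measurable_itv.
have e2 : 0 < 2 ^+ n :> R by rewrite exprn_gt0.
have E j (k : int) (t : R) : (a 0 j + k%:~R / 2 ^+ n * l <= t) = (k%:~R <= 2 ^+ n * ((t - a 0 j) / l)).
  by rewrite addrC -lerBrDr -ler_pdivlMr// ler_pdivrMr// mulrC.
apply/seteqP; split => x /= xv.
  apply/ffunP => j; rewrite ffunE; apply/eqP; rewrite floor_eq.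
  have := xv j; rewrite in_itv/= E => /andP[-> /=].
  by rewrite ltNge E -ltNge.
move=> j; have := congr1 (fun u : {ffun 'I_d -> int} => u j) xv; rewrite ffunE => <-.
by rewrite in_itv/= E floor_le/= ltNge E -ltNge; exact: floorD1_gt.
Qed.

Lemma grid_set_measurable n A : grid_set n A -> measurable A.
Proof.
move=> gA.
rewrite (_ : A = \bigcup_(v in [set v | exists2 x, A x & grid_label n x = v])
    [set x : 'rV[R]_d | grid_label n x = v]).
  rewrite bigcup_mkcond; apply: countable_bigcupT_measurable => // v.
  by case: ifP => // _; exact: measurable_grid_cell.
apply/seteqP; split => x /=; first by move=> Ax; exists (grid_label n x) => //; exists x.
by move=> [v [y Ay <-] /= yx]; exact: gA Ay.
Qed.

Lemma open_grid_sets A : open (A : set 'rV[R]_d) ->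
  A = \bigcup_n [set x : 'rV[R]_d | forall y, grid_label n x = grid_label n y -> A y].
Proof.
move=> oA; apply/seteqP; split => x; last by move=> [n _]; exact.
move=> Ax; have /nbhs_ballP[e /= e0 eA] : nbhs (x : 'rV[R]_d) A by exact: open_nbhs_nbhs.
have [n ln] : exists n : nat, l / e < 2 ^+ n.
  exists (Num.truncn (l / e)).+1; apply: lt_le_trans (truncnS_gt _) _.
  by rewrite -natrX ler_nat ltnW// ltn_expl.
have e2 : 0 < 2 ^+ n :> R by rewrite exprn_gt0.
exists n => // y xy; apply: eA; split => // i j; rewrite (ord1 i).
rewrite /ball/= ltr_distlC.
pose fx := 2 ^+ n * ((x 0 j - a 0 j) / l); pose fy := 2 ^+ n * ((y 0 j - a 0 j) / l).
have fE : Num.floor fx = Num.floor fy.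
  by have := congr1 (fun u : {ffun 'I_d -> int} => u j) xy; rewrite !ffunE.
have h1 := floor_le fx; have h2 := floor_le fy.
have h3 := floorD1_gt fx; have h4 := floorD1_gt fy.
have lt1 : `|fx - fy| < 1.
  by rewrite fE in h1 h3; rewrite ltr_norml; move: h1 h2 h3 h4; rewrite intrD; lra.
have : `|x 0 j - y 0 j| < e.
  have -> : x 0 j - y 0 j = (fx - fy) * (l / 2 ^+ n).
    by rewrite /fx /fy; field; rewrite !gt_eqF.
  rewrite normrM [X in _ * X]gtr0_norm ?divr_gt0//.
  apply: (@lt_le_trans _ _ (1 * (l / 2 ^+ n))).
    by rewrite ltr_pM2r// divr_gt0.
  by rewrite mul1r ler_pdivrMr// mulrC -ler_pdivrMr// ltW.
by rewrite ltr_distlC; lra.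
Qed.

Variable mu : {measure set (@borelRd R d) -> \bar R}.
Hypothesis mufin : (mu setT < +oo)%E.

Let apx A := measurable A /\ forall eps : R, 0 < eps -> exists n, exists2 B, grid_set n B &
  (mu ((A `\` B) `|` (B `\` A)) < eps%:E)%E.

Let apx_grid n A : grid_set n A -> apx A.
Proof.
move=> gA; split; first exact: grid_set_measurable gA.
by move=> eps eps0; exists n, A => //; rewrite setDv setU0 measure0.
Qed.

Let apxC A : apx A -> apx (~` A).
Proof.
move=> [mA aA]; split; first exact: measurableC.
move=> eps eps0; have [n [B gB AB]] := aA _ eps0; exists n, (~` B); first exact: grid_setC.
apply: le_lt_trans AB; rewrite le_measure ?inE//.
- have mB := grid_set_measurable gB.
  by apply: measurableU; apply: measurableD => //; exact: measurableC.
- have mB := grid_set_measurable gB.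
  by apply: measurableU; exact: measurableD.
by move=> x [[nA nnB]|[nB nnA]]; [right|left]; split => //; exact: contrapT.
Qed.

Let apxU A A' : apx A -> apx A' -> apx (A `|` A').
Proof.
move=> [mA aA] [mA' aA']; split; first exact: measurableU.
move=> eps eps0; have e20 : 0 < eps / 2 by rewrite divr_gt0.
have [n [B gB AB]] := aA _ e20; have [n' [B' gB' AB']] := aA' _ e20.
exists (maxn n n'), (B `|` B').
  by apply: grid_setU; [apply: grid_set_le gB; exact: leq_maxl|apply: grid_set_le gB'; exact: leq_maxr].
have mB := grid_set_measurable gB; have mB' := grid_set_measurable gB'.
rewrite [eps]splitr EFinD; apply: le_lt_trans (lteD AB AB').
apply: le_trans (measureU2 _ _ _); [|by apply: measurableU; exact: measurableD..].
rewrite le_measure ?inE//.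
- by apply: measurableU; apply: measurableD; exact: measurableU.
- by apply: measurableU; apply: measurableU; exact: measurableD.
move=> x [[[Ax|Ax] /not_orP[nB nB']]|[[Bx|Bx] /not_orP[nA nA']]].
- by left; left.
- by right; left.
- by left; right.
- by right; right.
Qed.

Let apx_bigcup (F : nat -> set (@borelRd R d)) : (forall n, apx (F n)) -> apx (\bigcup_n F n).
Proof.
move=> aF; have mF n : measurable (F n) by have [] := aF n.
have mU : measurable (\bigcup_n F n) by exact: bigcupT_measurable.
split => // eps eps0; have e20 : 0 < eps / 2 by rewrite divr_gt0.
pose U m := \big[setU/set0]_(i < m) F i.
have aU m : apx (U m).
  rewrite /U; elim: m => [|m IH]; last by rewrite big_ord_recr; exact: apxU.
  by rewrite big_ord0; apply: (apx_grid (n := 0%N)).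
have mUm m : measurable (U m) by have [] := aU m.
pose D m := \bigcup_n F n `\` U m.
have mD m : measurable (D m) by exact: measurableD.
have : mu \o D @ \oo --> mu (\bigcap_m D m).
  apply: nonincreasing_cvg_mu => //.
  - by apply: le_lt_trans mufin; rewrite le_measure ?inE.
  - exact: bigcapT_measurable.
  - move=> p q pq; apply/subsetPset; apply: setDS.
    by rewrite /U -!bigcup_mkord; apply: bigcup_sub => i /= ip; apply: bigcup_sup; exact: leq_trans ip pq.
rewrite (_ : \bigcap_m D m = set0) ?measure0; last first.
  apply/seteqP; split => // x Dx; have [[n _ Fx] _] := Dx 0%N I.
  by have [_] := Dx n.+1 I; apply; rewrite /U -bigcup_mkord; exists n => /=.
move=> D0.
have [m Dm] : exists m, (mu (D m) < (eps / 2)%:E)%E.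
  have : \forall m \near \oo, (mu (D m) < (eps / 2)%:E)%E.
    apply: (D0 [set u | (u < (eps / 2)%:E)%E]); apply: open_nbhs_nbhs; split.
      exact: open_ereal_lt_ereal.
    by rewrite /= lte_fin.
  by move=> [m _ /(_ m (leqnn m)) Dm]; exists m.
have [n [B gB AB]] := (aU m).2 _ e20.
exists n, B => //; have mB := grid_set_measurable gB.
rewrite [eps]splitr EFinD; apply: le_lt_trans (lteD Dm AB).
apply: le_trans (measureU2 _ _ _) => //; last by apply: measurableU; exact: measurableD.
rewrite le_measure ?inE//.
- by apply: measurableU; exact: measurableD.
- by apply: measurableU => //; apply: measurableU; exact: measurableD.
move=> x [[Ux nB]|[Bx nU]].
  by have [Umx|nUm] := pselect (U m x); [right; left|left].
right; right; split => // Umx; apply: nU.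
by move: Umx; rewrite /U -bigcup_mkord => -[i _ Fi]; exists i.
Qed.

(** The sets that are approximated by grid sets form a sigma-algebra, and it
    contains every open set because the latter is a union of grid sets. *)
Lemma grid_set_approx A (eps : R) : measurable A -> 0 < eps ->
  exists n, exists2 B, grid_set n B & (mu ((A `\` B) `|` (B `\` A)) < eps%:E)%E.
Proof.
move=> mA; suff [_] : apx A by exact.
apply: (mA apx); split.
- split; first by apply: (apx_grid (n := 0%N)).
  + by move=> B aB; rewrite setTD; exact: apxC.
  + exact: apx_bigcup.
move=> B oB; rewrite (open_grid_sets oB); apply: apx_bigcup => n.
apply: (apx_grid (n := n)) => x y xy /= Hx z yz; apply: Hx; exact: etrans yz.
Qed.

End dyadic_grid.

(** * The Poincare inequality on a cube *)

Lemma ae_mono d (T : measurableType d) (R : realType)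
    (mu : {measure set T -> \bar R}) (P P' : T -> Prop) :
  (forall x, P x -> P' x) -> {ae mu, forall x, P x} -> {ae mu, forall x, P' x}.
Proof. by move=> PP' [N [mN N0 sN]]; exists N; split => // x nP'; apply: sN => /PP'. Qed.

Lemma ae_and d (T : measurableType d) (R : realType)
    (mu : {measure set T -> \bar R}) (P P' : T -> Prop) :
  {ae mu, forall x, P x} -> {ae mu, forall x, P' x} -> {ae mu, forall x, P x /\ P' x}.
Proof.
move=> nP nP'; apply: negligibleS (negligibleU nP nP') => x /= /not_andP[]; by [left|right].
Qed.

Section cube_poincare.
Context {R : realType} {d : nat} {Omega : set 'rV[R]_d}.
Variables (oOmega : open Omega) (bOmega : bounded_set Omega).
Local Notation L := (@lebesgue_Rd R d).
Local Notation mu := (lebesgue_on oOmega).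
Variables (Q : set 'rV[R]_d) (a : 'rV[R]_d) (l : R).
Hypotheses (cQ : is_cube Q a l) (QO : Q `<=` Omega).
Implicit Types (w : @borelRd R d -> R).

Let l0 : 0 < l. Proof. by case: cQ. Qed.
Let mQ : measurable (Q : set (@borelRd R d)). Proof. by case: cQ. Qed.
Let bQ : box a (a + const_mx l) `<=` Q. Proof. by have [] := is_cubeE cQ. Qed.
Let Qc : Q `<=` cbox a (a + const_mx l). Proof. by have [] := is_cubeE cQ. Qed.
Let mufin := mu_setT_lty oOmega bOmega.

Definition in_grid_box (n : nat) (x : 'rV[R]_d) := exists m : {ffun 'I_d -> 'I_(2 ^ n)},
  forall j, node a l (2 ^ n) j (m j) < x 0 j < node a l (2 ^ n) j (m j).+1.

Let M0 n : 0 < (2 ^ n)%:R :> R. Proof. by rewrite ltr0n expn_gt0. Qed.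

Lemma node_lt_label n (x : 'rV[R]_d) j (m : 'I_(2 ^ n)) :
  node a l (2 ^ n) j m < x 0 j < node a l (2 ^ n) j m.+1 -> grid_label a l n x j = Posz m.
Proof.
pose r := l / (2 ^ n)%:R; have r0 : 0 < r by rewrite divr_gt0.
rewrite /node -/r -natr1 => /andP[h1 h2]; rewrite ffunE; apply/eqP; rewrite floor_eq.
rewrite (_ : 2 ^+ n * _ = (x 0 j - a 0 j) / r); last first.
  by rewrite /r natrX; field; rewrite !gt_eqF// exprn_gt0.
rewrite intrD ler_pdivlMr// ltr_pdivrMr// -[(Posz m)%:~R]/(m%:R) -[(Posz 1)%:~R]/(1 : R).
by lra.
Qed.

(** What is left out lies in finitely many faces. *)
Lemma ae_in_grid_box n : {ae mu, forall x, Q x -> in_grid_box n x}.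
Proof.
pose F (jp : 'I_d * 'I_(2 ^ n).+1) : set (@borelRd R d) :=
  cbox a (a + const_mx l) `&` [set x : 'rV[R]_d | x 0 jp.1 = node a l (2 ^ n) jp.1 jp.2].
have LF : L.-negligible ((Q : set (@borelRd R d)) `\` [set x : 'rV[R]_d | in_grid_box n x]).
  apply: (@negligibleS _ _ _ _ ((cbox a (a + const_mx l) `\` box a (a + const_mx l)) `|` \bigcup_jp F jp)); last first.
    apply: negligibleU; first exact: negligible_faces.
    apply: negligible_bigcup_fin => jp; exists (F jp); split => //.
      apply: measurableI; first exact: measurable_cbox.
      exact: (@measurable_coord_set _ _ _ [set _]).
    exact: lebesgue_face.
  move=> x [Qx nx]; have cx := Qc Qx.
  have [bx|nbx] := pselect (box a (a + const_mx l) x); last by left.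
  right; apply: contrapT => nF; apply: nx.
  have H j : exists m : 'I_(2 ^ n), node a l (2 ^ n) j m < x 0 j < node a l (2 ^ n) j m.+1.
    pose y := 2 ^+ n * ((x 0 j - a 0 j) / l).
    have := bx j; rewrite !mxE => /andP[ax xl].
    have e2 : 0 < 2 ^+ n :> R by rewrite exprn_gt0.
    have y0 : 0 <= y by rewrite mulr_ge0 ?divr_ge0 ?ltW// subr_gt0.
    have yM : y < (2 ^ n)%:R.
      by rewrite natrX /y gtr_pMr// ltr_pdivrMr// mul1r ltrBlDl.
    have tM : (Num.truncn y < 2 ^ n)%N by rewrite -(ltr_nat R) (le_lt_trans _ yM)// truncn_le.
    have nodeE (p : nat) : node a l (2 ^ n) j p = a 0 j + p%:R * l / 2 ^+ n.
      by rewrite /node natrX mulrA.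
    have xE : x 0 j = a 0 j + y * l / 2 ^+ n by rewrite /y; field; rewrite !gt_eqF.
    exists (Ordinal tM) => /=; rewrite !nodeE xE.
    rewrite !ltrD2l !ltr_pM2r ?invr_gt0//; apply/andP; split; last exact: truncnS_gt.
    rewrite lt_neqAle truncn_le y0 andbT.
    apply/eqP => ty; apply: nF; exists (j, Ordinal (ltnW tM : (Num.truncn y < (2 ^ n).+1)%N)) => //; split => //=.
    by rewrite nodeE ty.
  by have /choice[m mP] := H; exists [ffun j => m j] => j; rewrite ffunE.
have [N [mN N0 sN]] := LF.
exists (N `&` (Q : set (@borelRd R d))); split; first exact: measurableI.
  rewrite mu_sub; last by move=> x [_ /QO].
  by apply/eqP; rewrite -measure_le0 -N0 le_measure ?inE//; exact: measurableI.
move=> x /= /not_implyP[Qx nx]; split => //; exact: sN.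
Qed.

Section grid_sign.
Variables (n : nat) (B : set (@borelRd R d)).
Hypothesis gB : grid_set a l n B.

Let g (x : @borelRd R d) : R := 2 * \1_B x - 1.

Let c (m : {ffun 'I_d -> 'I_(2 ^ n)}) : R :=
  2 * `[< exists x, grid_label a l n x = [ffun j => Posz (m j)] /\ B x >]%:R - 1.

Let c1 m : `|c m| <= 1.
Proof. by rewrite /c; case: asboolP => _; rewrite ler_norml /=; lra. Qed.

Let g1 x : `|g x| <= 1.
Proof. by rewrite /g indicE; case: (_ \in _); rewrite ler_norml /=; lra. Qed.

Let mB : measurable B := grid_set_measurable l0 gB.

Let mg : measurable_fun setT g.
Proof.
apply: measurable_funB => //; apply: measurable_funM => //.
Qed.

Let gc (x : 'rV[R]_d) (m : {ffun 'I_d -> 'I_(2 ^ n)}) :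
  (forall j, node a l (2 ^ n) j (m j) < x 0 j < node a l (2 ^ n) j (m j).+1) -> g x = c m.
Proof.
move=> xm; rewrite /g /c indicE; congr (2 * _%:R - 1); congr nat_of_bool.
have xE : grid_label a l n x = [ffun j => Posz (m j)].
  by apply/ffunP => j; rewrite (node_lt_label (xm j)) ffunE.
apply/idP/asboolP => [|[y [yE By]]]; rewrite inE; first by exists x.
by apply: gB By; rewrite yE xE.
Qed.

Definition grid_mean : R := ((2 ^ n)%:R^-1) ^+ d * \sum_m c m.

Definition grid_eps (r : nat) : R := l / (2 ^ n)%:R / (5 * r.+1%:R).

Let e0 r : 0 < grid_eps r.
Proof. by rewrite divr_gt0 ?mulr_gt0// divr_gt0. Qed.

Let eM r : 4 * grid_eps r < l / (2 ^ n)%:R.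
Proof.
have h : 0 < l / (2 ^ n)%:R by rewrite divr_gt0.
rewrite /grid_eps mulrCA gtr_pMr// ltr_pdivrMr ?mul1r ?mulr_gt0//.
have : (1 : R) <= r.+1%:R by rewrite ler1n.
lra.
Qed.

Let e_cvg : grid_eps r @[r --> \oo] --> 0.
Proof.
have -> : grid_eps = (fun r => l / (2 ^ n)%:R / 5 * harmonic r).
  by apply/funext => r; rewrite /grid_eps /harmonic /= invfM mulrA.
rewrite -[X in _ --> X](mulr0 (l / (2 ^ n)%:R / 5)).
by apply: cvgMl_tmp; exact: cvg_harmonic.
Qed.

Definition grid_field (r : nat) := cube_field a l (grid_eps r) c.

Lemma grid_field_test r : [/\ forall k, C1 (fun x => grid_field r x 0 k),
  forall x k, `|grid_field r x 0 k| <= l,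
  forall x, grid_field r x != 0 -> cbox (a + const_mx (grid_eps r)) (a + const_mx (l - grid_eps r)) x
  & 0 < grid_eps r].
Proof.
split => //.
- by move=> k; exact: cube_field_C1.
- by move=> x k; apply: cube_field_bound; rewrite ?expn_gt0.
- by move=> x; apply: cube_field_supp; rewrite ?expn_gt0.
Qed.

Let div_cvg (x : 'rV[R]_d) : in_grid_box n x ->
  divergence (grid_field r) x @[r --> \oo] --> g x - grid_mean.
Proof.
move=> [m xm]; rewrite (gc xm).
have near_e (u : R) : 0 < u -> \forall r \near \oo, 3 * grid_eps r <= u.
  move=> u0; have u3 : 0 < u / 3 by rewrite divr_gt0.
  near=> r; have : grid_eps r <= u / 3.
    by near: r; apply: (cvgr_le _ e_cvg).
  by lra.
pose K r := ((l / (2 ^ n)%:R - 4 * grid_eps r) / (l - 4 * grid_eps r)) ^+ d.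
have KE : \forall r \near \oo, c m - K r * \sum_m c m = divergence (grid_field r) x.
  have : \forall r \near \oo, forall j, node a l (2 ^ n) j (m j) + 3 * grid_eps r <= x 0 j <= node a l (2 ^ n) j (m j).+1 - 3 * grid_eps r.
    apply: filter_forall => j; have /andP[h1 h2] := xm j.
    near=> r; apply/andP; split.
      rewrite -lerBrDl; near: r; apply: near_e; by rewrite subr_gt0.
    rewrite lerBrDr -lerBrDl; near: r; apply: near_e; by rewrite subr_gt0.
  apply: filterS => r xr; apply/esym; apply: cube_field_divergence_in => //.
  by rewrite expn_gt0.
have kc : (l / (2 ^ n)%:R - 4 * grid_eps r) / (l - 4 * grid_eps r) @[r --> \oo] --> ((2 ^ n)%:R^-1 : R).
  rewrite [X in _ --> X](_ : _ = (l / (2 ^ n)%:R - 4 * 0) / (l - 4 * 0)); last first.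
    by field; rewrite !gt_eqF.
  have ec (u : R) : u - 4 * grid_eps r @[r --> \oo] --> u - 4 * 0.
    by apply: cvgB; [exact: cvg_cst|apply: cvgMl_tmp; exact: e_cvg].
  apply: cvgM; first exact: ec.
  by apply: cvgV; [rewrite mulr0 subr0 gt_eqF|exact: ec].
have Kc : K r @[r --> \oo] --> ((2 ^ n)%:R^-1 ^+ d : R).
  exact: (cvg_comp _ _ kc (@exprn_continuous _ d _)).
apply: cvg_trans (near_eq_cvg KE) _.
apply: cvgB; first exact: cvg_cst.
by apply: cvgMr_tmp; exact: Kc.
Unshelve. all: by end_near. Qed.

(** Near a fixed point off the faces, the smoothed grid function is eventually
    equal to [g], so dominated convergence applies. *)
Lemma grid_field_cvg w : mu.-integrable setT (EFin \o w) ->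
  \int[mu]_x (w x * divergence (grid_field r) x) @[r --> \oo] -->
  \int[mu]_(x in Q) (w x * (g x - grid_mean)).
Proof.
move=> iw.
rewrite (_ : (fun r => _) = fun r => \int[mu]_(x in Q) (w x * divergence (grid_field r) x)); last first.
  apply/funext => r; rewrite [RHS]Rintegral_mkcond; apply: eq_Rintegral => x _.
  rewrite patchE; case: ifPn => // xQ.
  rewrite (_ : divergence _ x = 0) ?mulr0//.
  apply: cube_field_divergence_out; rewrite ?expn_gt0//.
  by move=> /bQ Qx; move: xQ; rewrite mem_set.
have cdiv r : continuous (divergence (grid_field r)).
  by apply: continuous_sum_fct => k; have [C1g _ _ _] := grid_field_test r; exact: (C1g k k).2.
apply: (@cvg_Rintegral_bounded _ _ _ _ _ _ _ _ #|{ffun 'I_d -> 'I_(2 ^ n)}|%:R) => //.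
- exact: integrableS iw.
- by move=> r; apply: measurable_funTS; exact: continuous_measurable_Rd.
- by apply: measurable_funTS; exact: measurable_funB.
- by move=> r x _; apply: cube_field_divergence_bound; rewrite ?expn_gt0.
- by apply: ae_mono (ae_in_grid_box n) => x H Qx; exact: div_cvg (H Qx).
Qed.

Let ig D : measurable D -> mu.-integrable D (EFin \o g).
Proof.
move=> mD; apply: (integrableS measurableT) => //.
by apply: (mu_bounded_integrable oOmega bOmega mg (M := 1)) => x _; exact: g1.
Qed.

(** Every grid box has the same volume, so the plain mean of the values [c] is
    the mean of [g] over the cube. *)
Lemma integral_grid_sign : \int[mu]_(x in Q) g x = grid_mean * fine (mu Q).
Proof.
pose box_m (m : {ffun 'I_d -> 'I_(2 ^ n)}) : set (@borelRd R d) :=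
  box (\row_j node a l (2 ^ n) j (m j)) (\row_j node a l (2 ^ n) j (m j).+1).
have mbox m : measurable (box_m m) by exact: measurable_box.
have nodeS j p : node a l (2 ^ n) j p.+1 = node a l (2 ^ n) j p + l / (2 ^ n)%:R.
  by rewrite /node -natr1; ring.
have h0 : 0 < l / (2 ^ n)%:R by rewrite divr_gt0.
have boxQ m : box_m m `<=` Q.
  move=> x xm; apply: bQ => j; have := xm j; rewrite !mxE => /andP[h1 h2].
  apply/andP; split.
    by apply: le_lt_trans h1; rewrite /node lerDl mulr_ge0// ltW.
  apply: (lt_le_trans h2); rewrite /node lerD2l mulrCA; apply: ler_piMr; first exact: ltW.
  by rewrite ler_pdivrMr// mul1r ler_nat; exact: ltn_ord.
have Lbox m : fine (mu (box_m m)) = (l / (2 ^ n)%:R) ^+ d.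
  rewrite mu_sub; last exact: subset_trans (boxQ m) QO.
  rewrite lebesgue_Rd_box => [|j]; last by rewrite !mxE nodeS lerDl ltW.
  rewrite /= (eq_bigr (fun=> l / (2 ^ n)%:R)) => [|j _]; last by rewrite !mxE nodeS addrC addKr.
  by rewrite prodr_const card_ord.
transitivity (\int[mu]_(x in Q) (\sum_m c m * \1_(box_m m) x)).
  rewrite /Rintegral; congr fine; apply: ae_eq_integral => //.
  - exact: (measurable_int _ (ig mQ)).
  - apply/measurable_EFinP/measurable_funTS; apply: measurable_sum => m.
    by apply: measurable_funM => //; exact: measurable_indic.
  apply: ae_mono (ae_in_grid_box n) => x H Qx; congr EFin.
  have [m xm] := H Qx; rewrite (gc xm) (bigD1 m)//= indicE mem_set ?mulr1; last first.
    by move=> j; rewrite !mxE; exact: xm.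
  rewrite big1 ?addr0// => m' mm'; rewrite indicE memNset ?mulr0// => xm'.
  move: mm'; have -> : m' = m; last by rewrite eqxx.
  apply/ffunP => j; apply/val_inj; have := xm' j; rewrite !mxE => /node_lt_label h'.
  by have := node_lt_label (xm j); rewrite h' => -[].
have ibox m : mu.-integrable Q (EFin \o (\1_(box_m m) : borelRd d -> R)).
  apply: (integrableS measurableT) => //; apply: (mu_bounded_integrable oOmega bOmega _ (M := 1)).
    exact: measurable_indic.
  by move=> x _; rewrite indicE; case: (_ \in _); rewrite ?normr1 ?normr0.
rewrite Rintegral_sum// => [|m]; last exact: (integrableZl mQ (c m) (ibox m)).
rewrite (mu_cube oOmega cQ QO) /grid_mean /= mulrAC -exprMn mulr_sumr.
apply: eq_bigr => m _; rewrite RintegralZl// mulrC; congr (_ * _).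
rewrite /Rintegral integral_indic// setIidl; last exact: boxQ.
by rewrite Lbox mulrC.
Qed.

End grid_sign.

(** Poincare inequality in dual form on one cube: a sign pattern for [w] minus
    its mean is approximated by grid sets, for which the test fields are known. *)
Lemma cube_poincare w (eps : R) : mu.-integrable setT (EFin \o w) -> 0 < eps ->
  exists phi : 'rV[R]_d -> 'rV[R]_d, exists2 e : R, 0 < e &
  [/\ forall k, C1 (fun x => phi x 0 k), forall x k, `|phi x 0 k| <= l,
      forall x, phi x != 0 -> cbox (a + const_mx e) (a + const_mx (l - e)) x
    & \int[mu]_(x in Q) `|w x - (fine (mu Q))^-1 * \int[mu]_(y in Q) w y| <=
      \int[mu]_x (w x * divergence phi x) + eps].
Proof.
move=> iw eps0; set w0 := (fine (mu Q))^-1 * _.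
have muQ0 : fine (mu Q) != 0 by rewrite (mu_cube oOmega cQ QO)/= expf_neq0// gt_eqF.
have iwQ : mu.-integrable Q (EFin \o w) by exact: integrableS iw.
have icst (r : R) D : measurable D -> mu.-integrable D (EFin \o cst r).
  move=> mD; apply: (integrableS measurableT) => //.
  by apply: (mu_bounded_integrable oOmega bOmega _ (M := `|r|)).
pose f x := w x - w0.
have f_int : mu.-integrable setT (EFin \o f).
  by apply: integrableB_real => //; exact: icst.
have mf : measurable_fun setT f by apply/measurable_EFinP; exact: measurable_int f_int.
pose A : set (@borelRd R d) := [set x | 0 <= f x].
have mA : measurable A.
  rewrite (_ : A = f @^-1` `[0, +oo[%classic).
    by rewrite -[X in measurable X]setTI; exact: mf.
  by apply/seteqP; split => x /=; rewrite in_itv/= andbT.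
have e40 : 0 < eps / 4 by rewrite divr_gt0.
have [del [del0 fdel]] := integral_normr_continuous f_int e40.
have [n [B gB AB]] := grid_set_approx a l0 mufin mA del0.
have mB := grid_set_measurable l0 gB.
set S := (A `\` B) `|` (B `\` A) in AB.
have mS : measurable S by apply: measurableU; exact: measurableD.
pose g (x : @borelRd R d) : R := 2 * \1_B x - 1.
have g1 x : `|g x| <= 1.
  by rewrite /g indicE; case: (_ \in _); rewrite ler_norml /=; lra.
have mg : measurable_fun setT g by apply: measurable_funB => //; apply: measurable_funM.
have ig : mu.-integrable setT (EFin \o g).
  exact: (mu_bounded_integrable oOmega bOmega mg (M := 1)).
have ifg : mu.-integrable setT (EFin \o (fun x => f x * g x)).
  by apply: (integrableM_bounded _ _ _ (M := 1)).
have ifS : mu.-integrable setT (EFin \o (fun x => `|f x| * \1_S x)).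
  apply: (integrableM_bounded _ _ _ (M := 1)) => //; first exact: (integrable_norm f_int).
  by move=> x _; rewrite indicE; case: (_ \in _); rewrite ?normr1 ?normr0.
(* Replacing the sign of [f] by [g] costs at most [2 |f|], and only where [A] and
   [B] differ. *)
have ptw x : `|f x| <= f x * g x + 2 * (`|f x| * \1_S x).
  rewrite /g !indicE.
  have [Ax|nAx] := pselect (A x); have [Bx|nBx] := pselect (B x).
  - rewrite (mem_set Bx) memNset/=; last by move=> [[]|[]].
    by rewrite (ger0_norm Ax); lra.
  - rewrite (memNset nBx) mem_set/=; last by left.
    by rewrite (ger0_norm Ax); move: Ax; rewrite /A/=; lra.
  - rewrite (mem_set Bx) mem_set/=; last by right.
    by have := normr_ge0 (f x); have := ler_norm (- f x); rewrite normrN; lra.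
  rewrite (memNset nBx) memNset/=; last by move=> [[]|[]].
  by move/negP: nAx; rewrite -ltNge => /ltW/ler0_norm ->; lra.
have iQ h : mu.-integrable setT (EFin \o h) -> mu.-integrable Q (EFin \o h).
  by move=> ih; exact: integrableS ih.
have step1 : \int[mu]_(x in Q) `|f x| <= \int[mu]_(x in Q) (f x * g x) + eps / 2.
  apply: (@le_trans _ _ (\int[mu]_(x in Q) (f x * g x + 2 * (`|f x| * \1_S x)))).
    apply: le_Rintegral => //.
    - exact: iQ (integrable_norm f_int).
    - apply: integrableD_real => //; first exact: iQ.
      by apply: integrableZ_real => //; exact: iQ.
  rewrite RintegralD//; [|exact: iQ|]; last first.
    by apply: integrableZ_real => //; exact: iQ.
  rewrite lerD2l RintegralZl//; last exact: iQ.
  have : \int[mu]_(x in Q) (`|f x| * \1_S x) <= eps / 4.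
    apply: le_trans (ltW (fdel S mS AB)).
    rewrite Rintegral_mkcond [leRHS]Rintegral_mkcond.
    have -> : (fun x => `|f x|) \_ S = (fun x => `|f x| * \1_S x).
      by apply/funext => x; rewrite patchE indicE; case: ifPn => xS; rewrite ?mulr1 ?mulr0.
    apply: le_Rintegral => //.
      by rewrite -restrict_EFin; apply/(integrable_mkcond _ mQ); exact: iQ.
    move=> x _; rewrite patchE; case: ifPn => // _.
    by rewrite mulr_ge0// indicE; case: (_ \in _).
  by lra.
have wQ : \int[mu]_(x in Q) w x = w0 * fine (mu Q) by rewrite /w0 mulrC mulVKf.
have step2 : \int[mu]_(x in Q) (w x * (g x - grid_mean n B)) = \int[mu]_(x in Q) (f x * g x).
  transitivity (\int[mu]_(x in Q) (f x * g x + (w0 * g x - grid_mean n B * w x))).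
    by apply: eq_Rintegral => x _; rewrite /f; ring.
  have i1 : mu.-integrable Q (EFin \o (fun x => w0 * g x)).
    by apply: integrableZ_real => //; exact: iQ.
  have i2 : mu.-integrable Q (EFin \o (fun x => grid_mean n B * w x)).
    exact: integrableZ_real.
  rewrite RintegralD//; [|exact: iQ|exact: integrableB_real].
  rewrite RintegralB// !RintegralZl//; [|exact: iQ].
  rewrite (integral_grid_sign gB) wQ; ring.
have e20 : 0 < eps / 2 by rewrite divr_gt0.
have /cvgrPdist_le/(_ _ e20)[r _ /(_ r (leqnn r)) /= Hr] := grid_field_cvg gB iw.
have [h1 h2 h3 h4] := grid_field_test n B r.
exists (grid_field n B r); exists (grid_eps n r) => //; split => //.
apply: (le_trans step1); move: Hr; rewrite -/g step2 => /ler_normlP[]; lra.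
Qed.

End cube_poincare.

(** * The Poincare inequality on a partition *)

Section partition_poincare.
Context {R : realType} {d : nat} {Omega : set 'rV[R]_d}.
Variables (oOmega : open Omega) (bOmega : bounded_set Omega) (neOmega : Omega !=set0).
Hypothesis d0 : (0 < d)%N.
Local Notation mu := (lebesgue_on oOmega).
Context {N : nat} {Q : 'I_N -> set 'rV[R]_d} {h : R}.
Hypothesis hQ : cube_partition Omega Q h.
Implicit Types (w : @borelRd R d -> R).

Lemma C1_gradient (f : 'rV[R]_d -> R) : C1 f -> gradient f (partial f).
Proof.
move=> C1f i; split; last exact: (C1f i).2.
by move=> x; split => //; exact: (C1f i).1.
Qed.

Lemma mesh_gt0 : 0 < h.
Proof.
have [_ QO [a [l [cQ ->]]]] := hQ; have [x] := neOmega; rewrite -QO => -[i _ _].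
by apply: lt_le_trans (le_bigmax _ _ i); have [] := cQ i.
Qed.

Lemma gradient0 : gradient (fun _ : 'rV[R]_d => 0) (fun _ _ => 0).
Proof. by move=> i; split => [x|]; [exact: is_derive_cst|exact: cst_continuous]. Qed.

Lemma TV_ge0 w : (0 <= TV oOmega w)%E.
Proof.
apply: ereal_sup_ubound; exists (fun=> 0).
  have supp0 : supp (fun _ : 'rV[R]_d => 0) = set0.
    rewrite /supp (_ : [set _ | _] = set0) ?closure0//.
    by apply/seteqP; split => // x; rewrite /= eqxx.
  split.
  - move=> i; rewrite (_ : (fun _ => _) = (fun=> 0)); first exact: gradient_C1 gradient0.
    by apply/funext => x; rewrite mxE.
  - by rewrite supp0; exact: compact0.
  - by rewrite supp0.
  - by move=> x; rewrite big1// => i _; rewrite mxE expr0n.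
apply: integral0_eq => x _; rewrite /divergence big1 ?mulr0// => k _.
rewrite (_ : (fun _ => _) = (fun=> 0)); first by rewrite (gradient_partial gradient0).
by apply/funext => y; rewrite mxE.
Qed.

Lemma divergenceZ_sum (c : R) (phi : 'I_N -> 'rV[R]_d -> 'rV[R]_d) :
  (forall i k, C1 (fun x => phi i x 0 k)) ->
  (forall k, C1 (fun x => (c *: \sum_i phi i x) 0 k)) /\
  (forall x, divergence (fun x => c *: \sum_i phi i x) x = c * \sum_i divergence (phi i) x).
Proof.
move=> C1phi.
have E k : (fun x => (c *: \sum_i phi i x) 0 k) = (fun x => c * \sum_i phi i x 0 k).
  by apply/funext => x; rewrite mxE summxE.
have G k := gradientZ c (gradient_sum (index_enum 'I_N) (fun i => C1_gradient (C1phi i k))).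
split; first by move=> k; rewrite E; exact: gradient_C1 (G k).
move=> x; rewrite /divergence.
rewrite (eq_bigr (fun k => c * \sum_i partial (fun y => phi i y 0 k) k x)) => [|k _]; last first.
  by rewrite E (gradient_partial (G k)).
by rewrite -mulr_sumr exchange_big.
Qed.

(** The test fields of the cubes have disjoint supports, so that their sum is
    again admissible in the definition of the total variation. *)
Lemma partition_poincare w (T : R) : mu.-integrable setT (EFin \o w) ->
  (TV oOmega w <= T%:E)%E ->
  \int[mu]_x `|w x - avg oOmega Q w x| <= Num.sqrt d%:R * h * T.
Proof.
move=> iw wT; have [tQ QO [a [l [cQ hE]]]] := hQ; have h0 := mesh_gt0.
have N0 : 0 < N%:R :> R.
  by have [x] := neOmega; rewrite -QO => -[i _ _]; rewrite ltr0n; exact: leq_trans (ltn_ord i).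
apply/ler_addgt0Pr => eps eps0.
have epsN : 0 < eps / N%:R by rewrite divr_gt0.
have QO' i : Q i `<=` Omega := @cell_sub _ _ _ _ _ _ hQ i.
have /choice[phi phiP] := fun i : 'I_N => cube_poincare bOmega (cQ i) (@QO' i) iw epsN.
have /choice[e eP] : forall i, exists e : R, 0 < e /\ 
  [/\ forall k, C1 (fun x => phi i x 0 k), forall x k, `|phi i x 0 k| <= l i,
      forall x, phi i x != 0 -> cbox (a i + const_mx e) (a i + const_mx (l i - e)) x
    & \int[mu]_(x in Q i) `|w x - (fine (mu (Q i)))^-1 * \int[mu]_(y in Q i) w y| <=
      \int[mu]_x (w x * divergence (phi i) x) + eps / N%:R].
  by move=> i; have [e e0 He] := phiP i; exists e.
have C1phi i k : C1 (fun x => phi i x 0 k) by have [_ []] := eP i.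
pose c := (Num.sqrt d%:R * h)^-1.
have sd0 : 0 < Num.sqrt d%:R :> R by rewrite sqrtr_gt0 ltr0n.
have c0 : 0 < c by rewrite invr_gt0 mulr_gt0.
pose Phi x := c *: \sum_i phi i x.
have [C1Phi divPhi] := divergenceZ_sum c C1phi.
pose K i := cbox (a i + const_mx (e i)) (a i + const_mx (l i - e i)).
have KQ i : K i `<=` Q i.
  move=> x Kx; have [_ _ + _] := is_cubeE (cQ i); apply => k.
  have [e0 _] := eP i; have := Kx k; rewrite !mxE; lra.
have phiK i x : phi i x != 0 -> K i x by have [_ [_ _ + _]] := eP i; exact.
have cdiv i : continuous (divergence (phi i)).
  by apply: continuous_sum_fct => k; exact: (C1phi i k k).2.
have iwdiv i : mu.-integrable setT (EFin \o (fun x => w x * divergence (phi i) x)).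
  exact: mu_integrableM_continuous.
have iwDiv : mu.-integrable setT (EFin \o (fun x => w x * divergence Phi x)).
  apply: mu_integrableM_continuous => //.
  by apply: continuous_sum_fct => k; exact: (C1Phi k k).2.
have PhiTest : @TV_test R d Omega Phi.
  have PhiK : [set x | Phi x != 0] `<=` \bigcup_i K i.
    move=> x; rewrite /= /Phi scaler_eq0 gt_eqF//= => nz.
    have [i phix] : exists i, phi i x != 0.
      apply: contrapT => /forallNP H; move: nz; rewrite big1 ?eqxx// => i _.
      by have /negP := H i; rewrite negbK => /eqP.
    by exists i => //; exact: phiK.
  have cK : closed (\bigcup_i K i : set 'rV[R]_d).
    by apply: closed_bigcup => [|i _]; [exact: finite_finset|exact: closed_cbox].
  have suppK : supp Phi `<=` \bigcup_i K i.
    by rewrite /supp [X in _ `<=` X](closure_id _).1//; exact: closureS.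
  have suppO : supp Phi `<=` Omega.
    by apply: subset_trans suppK _; apply: bigcup_sub => i _; exact: subset_trans (KQ i) (QO' i).
  split => //.
    have [a' [b' Oab]] := Omega_cbox bOmega.
    apply: (@subclosed_compact _ _ (cbox a' b' : set 'rV[R]_d)).
    - exact: closed_closure.
    - exact: compact_cbox.
    - exact: subset_trans suppO Oab.
  move=> x; have [Phi0|/PhiK[i _ Kx]] := eqVneq (Phi x) 0.
    by rewrite Phi0 big1// => k _; rewrite mxE expr0n.
  have -> : Phi x = c *: phi i x.
    rewrite /Phi (bigD1 i)//= big1 ?addr0// => j ji.
    apply/eqP; rewrite -[_ == _]negbK; apply/negP => /phiK Kjx.
    by move: ji; rewrite (tQ j i I I) ?eqxx//; exists x; split; exact: KQ.
  apply: (@le_trans _ _ (\sum_(k < d) (c * h) ^+ 2)).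
    apply: ler_sum => k _; rewrite mxE !exprMn ler_wpM2l ?sqr_ge0//.
    have h_nneg : h \is Num.nneg by rewrite nnegrE ltW.
    rewrite -[leLHS]real_normK ?num_real// ler_sqr ?nnegrE//.
    have [_ [_ + _ _]] := eP i => /(_ x k)/le_trans; apply.
    by rewrite hE; exact: le_bigmax.
  have -> : c * h = (Num.sqrt d%:R)^-1 by rewrite /c; field; rewrite !gt_eqF.
  rewrite sumr_const card_ord exprVn sqr_sqrtr// -[leLHS]mulr_natr mulVf//.
  by rewrite pnatr_eq0 -lt0n.
have : ((\int[mu]_x (w x * divergence Phi x))%:E <= T%:E)%E.
  apply: le_trans wT; rewrite /Rintegral fineK; last exact: integrable_fin_num.
  by apply: ereal_sup_ubound; exists Phi.
rewrite lee_fin.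
have -> : \int[mu]_x (w x * divergence Phi x) = c * \sum_i \int[mu]_x (w x * divergence (phi i) x).
  rewrite -Rintegral_sum// -RintegralZl//; last first.
    exact: integrable_sum_real.
  by apply: eq_Rintegral => x _; rewrite divPhi mulrCA -mulr_sumr.
rewrite ler_pdivrMl ?mulr_gt0// => HT.
rewrite (integral_cells hQ); last first.
  apply: integrable_norm; apply: integrableB_real => //.
  exact: (step_fct_integrable oOmega bOmega hQ).
apply: (@le_trans _ _ (\sum_i (\int[mu]_x (w x * divergence (phi i) x) + eps / N%:R))).
  apply: ler_sum => i _; have [_ [_ _ _]] := eP i; apply: le_trans.
  rewrite le_eqVlt; apply/orP; left; apply/eqP; apply: eq_Rintegral => x; rewrite inE => Qx.
  by rewrite /avg (step_fctE hQ _ Qx) mxE.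
rewrite big_split/= sumr_const card_ord -[_ / _ *+ _]mulr_natr -mulrA mulVf ?gt_eqF// mulr1.
by rewrite lerD2r.
Qed.

End partition_poincare.

(** * Relaxed problems and bound tightening *)

Section McCormick_relaxation.
Context {R : realType} {N : nat}.
Implicit Types (b : cell_bounds R N) (pu pw z m : R).

(** Each inequality says that a product of two distances to bounds is
    nonnegative. *)
Lemma McCormick_product b i pu pw : u_lo b i <= pu <= u_up b i ->
  w_lo b i <= pw <= w_up b i -> McCormick b i pu pw (pu * pw).
Proof. by move=> ? ?; split => //; nra. Qed.

(** The new inequalities for [z] differ from the old ones by [m - u_lo b i] times
    the distance of [pw] to one of its bounds. *)
Lemma McCormick_set_u_lo b i k m pu pw z : u_lo b i <= m ->
  w_lo b k <= pw <= w_up b k -> McCormick (set_u_lo b i m) k pu pw z ->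
  McCormick b k pu pw z.
Proof.
move=> lm wk; rewrite /McCormick /=; case: eqVneq => // ki; rewrite ki in wk *.
have p1 : 0 <= (m - u_lo b i) * (pw - w_lo b i) by apply: mulr_ge0; lra.
have p2 : 0 <= (m - u_lo b i) * (w_up b i - pw) by apply: mulr_ge0; lra.
by case=> *; split; lra.
Qed.

Lemma McCormick_set_u_up b i k m pu pw z : m <= u_up b i ->
  w_lo b k <= pw <= w_up b k -> McCormick (set_u_up b i m) k pu pw z ->
  McCormick b k pu pw z.
Proof.
move=> mu wk; rewrite /McCormick /=; case: eqVneq => // ki; rewrite ki in wk *.
have p1 : 0 <= (u_up b i - m) * (pw - w_lo b i) by apply: mulr_ge0; lra.
have p2 : 0 <= (u_up b i - m) * (w_up b i - pw) by apply: mulr_ge0; lra.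
by case=> *; split; lra.
Qed.

End McCormick_relaxation.

Section Lnorm_interpolation.
Context d (T : measurableType d) (R : realType) (mu : {measure set T -> \bar R}).
Implicit Types f : T -> R.

Lemma Lnorm_infty_ae f (m : R) : ('N[mu]_+oo[EFin \o f] <= m%:E)%E ->
  {ae mu, forall x, `|f x| <= m}.
Proof.
rewrite unlock /Lnorm; case: ifPn => [_ /ess_supP|].
  by apply: ae_mono => x /=; rewrite lee_fin.
rewrite -leNgt => mu0 _; exists setT; split => //.
by apply/eqP; rewrite eq_le mu0 measure_ge0.
Qed.

Lemma Lnorm2_le_interpolation f (m : R) : mu.-integrable setT (EFin \o f) -> 0 <= m ->
  {ae mu, forall x, `|f x| <= m} ->
  ('N[mu]_2%:E[EFin \o f] <= (m * \int[mu]_x `|f x|)%:E `^ 2^-1)%E.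
Proof.
move=> fi m0 fm; have mf : measurable_fun setT f by apply/measurable_EFinP; exact: measurable_int fi.
rewrite unlock /Lnorm; apply: gt0_ler_poweR; first by rewrite invr_ge0.
- by rewrite in_itv/= leey andbT; apply: integral_ge0 => x _; rewrite lee_fin powR_ge0.
- by rewrite in_itv/= leey andbT lee_fin mulr_ge0//; apply: Rintegral_ge0.
have nfi : mu.-integrable setT (EFin \o (fun x => `|f x|)) := integrable_norm fi.
apply: (@le_trans _ _ (\int[mu]_x (m * `|f x|)%:E)%E); last first.
  rewrite -RintegralZl// /Rintegral fineK//.
  by apply: integrable_fin_num => //; exact: integrableZ_real.
under eq_integral do rewrite /= powR_mulrn//.
apply: ae_ge0_le_integral => //.
- apply/measurable_EFinP; apply: measurable_funX; exact: measurableT_comp.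
- by move=> x _; rewrite lee_fin mulr_ge0.
- by apply/measurable_EFinP; apply: measurable_funM => //; exact: measurableT_comp.
by apply: ae_mono fm => x fx _; rewrite lee_fin expr2 ler_wpM2r.
Qed.

End Lnorm_interpolation.

Section relaxed_problems.
Context {R : realType} {d : nat} {Omega : set 'rV[R]_d}.
Variables (oOmega : open Omega) (bOmega : bounded_set Omega).
Local Notation mu := (lebesgue_on oOmega).
Context {N : nat} {Q : 'I_N -> set 'rV[R]_d} {h : R}.
Hypothesis hQ : cube_partition Omega Q h.

Lemma step_fctM (c c' : 'rV[R]_N) :
  step_fct Q c \* step_fct Q c' = step_fct Q (\row_i (c 0 i * c' 0 i)).
Proof.
apply/funext => x /=; have [[i Qx]|nQ] := pselect (exists i, Q i x).
  by rewrite !(step_fctE hQ _ Qx) mxE.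
rewrite /step_fct !big1 ?mul0r// => i _; rewrite indicE memNset ?mulr0//;
  by move=> Qx; apply: nQ; exists i.
Qed.

Context {U : completeNormedModType R} (e : U -> @borelRd R d -> R) (A : U -> U -> R)
  (f : U -> R) (C : set (@borelRd R d -> R)) (wl wu : @borelRd R d -> R).
Local Notation feasible := (McChh_feasible oOmega e A f C wl wu Q).
Local Notation step := (OBBT_step oOmega e A f C wl wu Q).
Variable b0 : cell_bounds R N.

Lemma OBBT_w_bounds b b' : step b b' -> w_lo b' = w_lo b /\ w_up b' = w_up b.
Proof. by move=> [i [m [_ [[_ ->]|[_ ->]]]]]. Qed.

(** For a degenerate interval [u_lo = u_up] the McCormick inequalities no longer
    contain the bounds of [w], which is why those have to be known separately. *)
Lemma feasible_OBBT_step b b' :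
  (forall c i, admissible oOmega C wl wu (step_fct Q c) -> w_lo b i <= c 0 i <= w_up b i) ->
  step b b' -> feasible b' `<=` feasible b.
Proof.
move=> wb [i [m [[[[u1 w1] z1] [_ _ M1] /= m1] bb']]] [[u w] z] [adm st M].
split => // k; have wk := wb _ k adm.
have := M k; have [_ _ _ _ /andP[]] := M1 i; rewrite m1 => lm mu.
case: bb' => -[_ ->]; first exact: McCormick_set_u_lo.
exact: McCormick_set_u_up.
Qed.

Lemma averaged_feasible b u w :
  admissible oOmega C wl wu (avg oOmega Q w) -> averaged_state_eq oOmega e A f Q u w ->
  (forall i, u_lo b i <= cell_avg oOmega Q (e u) i <= u_up b i) ->
  (forall i, w_lo b i <= cell_avg oOmega Q w i <= w_up b i) ->
  feasible b (u, \row_i cell_avg oOmega Q w i,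
    \row_i (cell_avg oOmega Q (e u) i * cell_avg oOmega Q w i)).
Proof.
move=> adm st ub wb; split => //.
  rewrite (_ : \row_i _ = \row_i ((\row_i cell_avg oOmega Q (e u) i) 0 i * (\row_i cell_avg oOmega Q w i) 0 i)).
    by rewrite -step_fctM.
  by apply/rowP => i; rewrite !mxE.
by move=> i; rewrite !mxE; exact: McCormick_product.
Qed.

(** A feasible point is among those over which the minimum or maximum is taken. *)
Lemma OBBT_keeps_cell_value b b' p : step b b' -> feasible b p -> forall i,
  u_lo b' i <= cell_avg oOmega Q (e p.1.1) i <= u_up b' i.
Proof.
move=> [i [m [_ bb']]] Fp k; have : u_lo b k <= cell_avg oOmega Q (e p.1.1) k <= u_up b k.
  by move: p Fp => [[u w] z] [_ _ /(_ k)[]].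
case: bb' => -[mb ->] /=; case: eqVneq => // -> /andP[h1 h2].
  by rewrite h2 andbT; apply: mb; exists p.
by rewrite h1; apply: mb; exists p.
Qed.

End relaxed_problems.

(** * Lower bounds and monotonicity *)

Unset Implicit Arguments. Set Strict Implicit.

Theorem theorem2p19 (R : realType) (d : nat) (Omega : set 'rV[R]_d)
  (hd : (0 < d)%N)
  (oOmega : open Omega) (cOmega : connected Omega)
  (bOmega : bounded_set Omega) (neOmega : Omega !=set0)
  (U : completeNormedModType R) (hU : reflexive_space U)
  (e : U -> @borelRd R d -> R)
  (he : compact_embedding oOmega e) (he' : dual_embedding oOmega e)
  (A : U -> U -> R) (hA : bounded_to_dual A) (hAinv : has_bounded_inverse A)
  (f : U -> R) (hf : dual f)
  (alpha : R) (halpha : 0 < alpha)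
  (j : U -> (@borelRd R d -> R) -> R) (hj : Lipschitz_on_bounded oOmega j)
  (C : set (@borelRd R d -> R)) (C0 : C !=set0) (CL2 : in_L2 oOmega C)
  (Cbounded : bounded_L2 oOmega C) (Cclosed : closed_L2 oOmega C)
  (Cconvex : convex_fct C)
  (hprod : forall u w, BV oOmega w -> in_dual oOmega e (e u \* w))
  (hstate : forall w, C w -> BV oOmega w ->
     exists! u : U, state_eq oOmega e A f u (e u \* w))
  (ul uu wl wu : @borelRd R d -> R)
  (hul : ul \in Lfun (lebesgue_on oOmega) 2%:E)
  (huu : uu \in Lfun (lebesgue_on oOmega) 2%:E)
  (hwl : wl \in Lfun (lebesgue_on oOmega) +oo%E)
  (hwu : wu \in Lfun (lebesgue_on oOmega) +oo%E)
  (hbounds : forall u w, BV oOmega w -> C w ->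
     state_eq oOmega e A f u (e u \* w) ->
     [/\ ae_le oOmega ul (e u), ae_le oOmega (e u) uu,
         ae_le oOmega wl w & ae_le oOmega w wu])
  (h : R) (N : nat) (Q : 'I_N -> set 'rV[R]_d)
  (hQ : cube_partition Omega Q h)
  (hstateh : forall w, BV oOmega w -> ae_le oOmega wl w -> ae_le oOmega w wu ->
     exists! u : U, averaged_state_eq oOmega e A f Q u w)
  (b0 : cell_bounds R N)
  (hb0 : forall u w, admissible oOmega C wl wu w ->
     averaged_state_eq oOmega e A f Q u w -> forall i,
     u_lo b0 i <= cell_avg oOmega Q (e u) i <= u_up b0 i /\
     w_lo b0 i <= cell_avg oOmega Q w i <= w_up b0 i)
  (TVh : (@borelRd R d -> R) -> \bar R)
  (TVh_ge0 : forall w, w \in Lfun (lebesgue_on oOmega) 1%E -> (0 <= TVh w)%E)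
  (TVh_lsc : lsc_L1 oOmega TVh)
  (TVh_TV : forall w, w \in Lfun (lebesgue_on oOmega) 1%E ->
     (TVh (avg oOmega Q w) <= TV oOmega w)%E)
  (TVh_avg : forall w, w \in Lfun (lebesgue_on oOmega) 1%E ->
     (TVh (avg oOmega Q w) <= TVh w)%E)
  (b : nat -> cell_bounds R N) (hb : b 0%N = b0)
  (hOBBT : forall n, OBBT_step oOmega e A f C wl wu Q (b n) (b n.+1)) :
  let m n := McChh_value oOmega e A f j alpha C wl wu Q TVh (b n) in
  (forall (wbar : @borelRd R d -> R) (ubar : U) (Lw : R),
     (exists u z, McCh_minimizer oOmega e A f j alpha C wl wu Q b0 (u, wbar, z)) ->
     averaged_state_eq oOmega e A f Q ubar wbar ->
     admissible oOmega C wl wu (avg oOmega Q wbar) ->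
     0 <= Lw -> Lipschitz_snd_on oOmega C j ubar Lw ->
     forall n,
     (m n - Lw%:E * Lp_norm oOmega +oo (wu \- wl)%R `^ 2^-1
              * (Num.sqrt d%:R)%:E `^ 2^-1 * TV oOmega wbar `^ 2^-1
              * h%:E `^ 2^-1
      <= McCh_objective oOmega j alpha ubar wbar)%E) /\
  {homo m : k l / (k <= l)%N >-> (k <= l)%E}.
Proof.
move=> m.
have muT : lebesgue_on oOmega setT \is a fin_num.
  by rewrite ge0_fin_numE//; exact: mu_setT_lty.
(* A step function has bounded variation, so the averaged equation has a solution
   for it, and the a priori bounds hold for its cell values. *)
have wb n c i : admissible oOmega C wl wu (step_fct Q c) ->
    w_lo (b n) i <= c 0 i <= w_up (b n) i.
  move=> adm; have -> : w_lo (b n) = w_lo b0.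
    by elim: n => [|n IH]; rewrite ?hb// (OBBT_w_bounds (hOBBT n)).1.
  have -> : w_up (b n) = w_up b0.
    by elim: n => [|n IH]; rewrite ?hb// (OBBT_w_bounds (hOBBT n)).2.
  have [_ wlc wcu] := adm.
  have [u [st _]] := hstateh _ (BV_step_fct oOmega bOmega hQ c) wlc wcu.
  have [_] := hb0 _ _ adm st i.
  by rewrite (cell_avg_step oOmega hQ) => /andP[-> ->].
have FS n : McChh_feasible oOmega e A f C wl wu Q (b n.+1) `<=`
    McChh_feasible oOmega e A f C wl wu Q (b n).
  by apply: feasible_OBBT_step (hOBBT n) => c i; exact: wb.
split; last first.
  apply: homo_leq => [x|y x z|n]; [exact: lexx|exact: le_trans|].
  by apply: le_ereal_inf; apply: image_subset; exact: FS.
move=> wbar ubar Lw [u0 [z0 [[admw _ _] _]]] st admavg Lw0 LL n.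
have [Cw _ _] := admw.
have wL2 := CL2 _ Cw.
have wL1 := Lfun_subset12 muT wL2.
have iw : (lebesgue_on oOmega).-integrable setT (EFin \o wbar) by exact/Lfun1_integrable.
have TV0 : (0 <= TV oOmega wbar)%E by exact: TV_ge0.
have [TVy|TVfin] := eqVneq (TV oOmega wbar) +oo%E.
  by rewrite /McCh_objective TVy gt0_muley ?lte_fin// addey// leey.
have {TVfin} [T TVT] : exists T : R, TV oOmega wbar = T%:E.
  by case: (TV oOmega wbar) TV0 TVfin => // T; exists T.
have T0 : 0 <= T by rewrite -lee_fin -TVT.
have avg_fin k : (forall i, u_lo (b k) i <= cell_avg oOmega Q (e ubar) i <= u_up (b k) i).
  elim: k => [|k IH] i.
    by rewrite hb; have [] := hb0 _ _ admw st i.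
  apply: (OBBT_keeps_cell_value (hOBBT k) (averaged_feasible hQ admavg st IH _)) => i'.
  by have := wb k _ i' admavg; rewrite mxE.
have mn : (m n <= (j ubar (avg oOmega Q wbar))%:E + alpha%:E * TVh (avg oOmega Q wbar))%E.
  apply: ereal_inf_lbound; eexists; first apply: (averaged_feasible hQ admavg st (avg_fin n)).
    by move=> i; have := wb n _ i admavg; rewrite mxE.
  by [].
have [M ME] : exists M : R, Lp_norm oOmega +oo (wu \- wl)%R = M%:E.
  have wuwl : (wu \- wl)%R \in Lfun (lebesgue_on oOmega) +oo%E.
    exact: (Lfun_addr_closed _ (leey 1)).2 _ _ hwu (Lfun_oppr_closed hwl).
  have := sub_Lfun_finLfun wuwl; rewrite inE /finite_norm => wlt.
  exists (fine (Lp_norm oOmega +oo (wu \- wl)%R)); rewrite fineK// ge0_fin_numE//.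
  exact: Lnorm_ge0.
have M0 : 0 <= M by rewrite -lee_fin -ME; exact: Lnorm_ge0.
have wM : {ae lebesgue_on oOmega, forall x, `|(wu \- wl) x| <= M}.
  by apply: Lnorm_infty_ae; rewrite -/(Lp_norm _ _ _) ME.
have [_ wl1 wu1] := admw; have [Cavg wl2 wu2] := admavg.
pose u x := wbar x - avg oOmega Q wbar x.
have uM : {ae lebesgue_on oOmega, forall x, `|u x| <= M}.
  apply: ae_mono (ae_and (ae_and wl1 wu1) (ae_and (ae_and wl2 wu2) wM)) => x.
  by rewrite /= !ler_norml /u; lra.
have iu : (lebesgue_on oOmega).-integrable setT (EFin \o u).
  by apply: integrableB_real => //; exact: (step_fct_integrable oOmega bOmega hQ).
have h0 := mesh_gt0 neOmega hQ.
have poin : \int[lebesgue_on oOmega]_x `|u x| <= Num.sqrt d%:R * h * T.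
  by apply: (partition_poincare bOmega neOmega hd hQ iw); rewrite TVT.
pose B := (M * (Num.sqrt d%:R * h * T)) `^ 2^-1.
have N2 : (Lp_norm oOmega 2%:E (wbar \- avg oOmega Q wbar)%R <= B%:E)%E.
  apply: le_trans (Lnorm2_le_interpolation iu M0 uM) _.
  rewrite poweR_EFin lee_fin ge0_ler_powR ?invr_ge0 ?nnegrE ?ler_wpM2l//.
  - by rewrite mulr_ge0// Rintegral_ge0.
  - by rewrite !mulr_ge0 ?sqrtr_ge0// ltW.
have LipB : `|j ubar wbar - j ubar (avg oOmega Q wbar)| <= Lw * B.
  rewrite -lee_fin EFinM; apply: le_trans (LL _ _ Cw Cavg) _.
  by apply: lee_wpmul2l N2; rewrite lee_fin.
rewrite /McCh_objective ME TVT !poweR_EFin -!EFinM -EFinD.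
have -> : Lw * M `^ 2^-1 * Num.sqrt d%:R `^ 2^-1 * T `^ 2^-1 * h `^ 2^-1 = Lw * B.
  have [sd0 h0'] := (sqrtr_ge0 (d%:R : R), ltW h0).
  have sdh0 : 0 <= Num.sqrt d%:R * h by exact: mulr_ge0.
  rewrite /B powRM ?mulr_ge0// powRM// powRM// [_ * h `^ _ * _]mulrAC.
  by rewrite !mulrA.
rewrite leeBlDr//; apply: (le_trans mn).
have Th : (TVh (avg oOmega Q wbar) <= T%:E)%E by rewrite -TVT; exact: TVh_TV.
apply: (@le_trans _ _ ((j ubar (avg oOmega Q wbar))%:E + alpha%:E * T%:E)%E).
  by rewrite leeD2l// lee_wpmul2l// lee_fin ltW.
rewrite -EFinM -!EFinD lee_fin; move: LipB => /ler_normlP[]; lra.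
Qed.
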